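(* The space $Sof(\mathbb{F}_2,P^\omega)$ of the free group $\mathbb{F}_2$ on two generators has uncountably many extreme points.
   Context: Fix a free ultrafilter $\omega$ on $\mathbb{N}$. $M_n$ is the algebra of $n\times n$ complex matrices with normalised trace $Tr(x)=\frac1n\sum_i x(i,i)$ and $P_n\subset M_n$ is the group of permutation matrices, with normalised Hamming distance $d_H(p,q)=1-Tr(p^{-1}q)$. For natural numbers $n_k$ with $\lim_k n_k=\infty$, $\Pi_{k\to\omega}P_{n_k}$ is the group of sequences in $\prod_kP_{n_k}$ modulo the sequences with $\lim_{k\to\omega}d_H(p_k,Id)=0$, with $Tr(\Pi_{k\to\omega}p_k)=\lim_{k\to\omega}Tr(p_k)$. A sofic representation of a countable group $G$ is a group homomorphism $\Theta:G\to\Pi_{k\to\omega}P_{n_k}$ with $Tr(\Theta(g))=0$ for all $g\neq 1_G$ (different sofic representations may use different sequences of dimensions). Its amplification by positive integers $(r_k)_k$ is $\Theta\otimes Id_{r_k}:G\to\Pi_{k\to\omega}P_{n_kr_k}$. Two sofic representations $\Theta:G\to\Pi_{k\to\omega}P_{n_k}$ and $\Psi:G\to\Pi_{k\to\omega}P_{m_k}$ are equivalent if there are positive integers $r_k,t_k$ with $n_kr_k=m_kt_k$ such that $\Theta\otimes Id_{r_k}$ and $\Psi\otimes Id_{t_k}$ are conjugate by an element of $\Pi_{k\to\omega}P_{n_kr_k}$. $[\Theta]$ is the class of $\Theta$, and $Sof(G,P^\omega)$ is the set of all classes. Convex structure: for $\lambda\in[0,1]$, $\lambda[\Theta]+(1-\lambda)[\Psi]$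 is the class of $(\Theta\otimes Id_{r_k})\oplus(\Psi\otimes Id_{t_k})$, where $r_k,t_k$ are positive integers with $\lim_{k\to\omega}\frac{n_kr_k}{n_kr_k+m_kt_k}=\lambda$ (the class is independent of choices). $[\Theta]$ is an extreme point if $[\Theta]=\lambda[\Psi_1]+(1-\lambda)[\Psi_2]$ with $0<\lambda<1$ implies $[\Psi_1]=[\Psi_2]=[\Theta]$. *)

(* Defs.v *)
From HB Require Import structures.
From mathcomp Require Import all_boot all_order all_algebra all_fingroup.
From mathcomp Require Import ring lra mxtens.
From mathcomp Require Import all_classical all_reals all_analysis.

Set Implicit Arguments.
Unset Strict Implicit.
Unset Printing Implicit Defensive.

Import Order.TTheory GRing.Theory Num.Theory.
Import numFieldNormedType.Exports.
Local Open Scope quotient_scope.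
Local Open Scope group_scope.

Section FreeGroup.
Variable X : choiceType.

(* [(x, true)] stands for the generator [x], [(x, false)] for its inverse. *)
Local Notation letter := (X * bool)%type.

Definition letter_inv (a : letter) : letter := (a.1, ~~ a.2).

Definition reduced (s : seq letter) : bool :=
  sorted [rel a b | b != letter_inv a] s.

Definition cons_red (a : letter) (s : seq letter) : seq letter :=
  if s is b :: s' then if b == letter_inv a then s' else a :: s else [:: a].

Record free_group := FreeGroup {
  fg_word :> seq letter;
  fg_reduced : reduced fg_word }.

HB.instance Definition _ := [isSub for fg_word].
HB.instance Definition _ := [Choice of free_group by <:].

Lemma letter_invK : involutive letter_inv.
Proof. by case=> x b; rewrite /letter_inv /= negbK. Qed.

Lemma reduced_cons_red a s : reduced s -> reduced (cons_red a s).
Proof.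
case: s => [|b s] //= sP; case: ifPn => [_|ba]; first by case: s sP => //= c s /andP[].
by rewrite /= ba.
Qed.

Lemma reduced_foldr s t : reduced t -> reduced (foldr cons_red t s).
Proof. by move=> tP; elim: s => //= a s; apply: reduced_cons_red. Qed.

Lemma cons_redK a s : reduced s -> cons_red (letter_inv a) (cons_red a s) = s.
Proof.
case: s => [|b s] /= sP; first by rewrite letter_invK eqxx.
case: ifPn => [/eqP ba|_] /=; last by rewrite letter_invK eqxx.
rewrite {b}ba in sP *.
by case: s sP => [|c s] //= /andP[/negPf ->].
Qed.

Lemma cons_redKV a s : reduced s -> cons_red a (cons_red (letter_inv a) s) = s.
Proof. by move=> sP; rewrite -{1}[a]letter_invK cons_redK. Qed.

Lemma foldr_cons_red a s t : reduced s -> reduced t ->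
  foldr cons_red t (cons_red a s) = cons_red a (foldr cons_red t s).
Proof.
move=> sP tP; case: s sP => [|b s] //= sP.
case: ifPn => [/eqP ->|//]; rewrite cons_redKV //; exact: reduced_foldr.
Qed.

Lemma foldr_cons_red_nil s : reduced s -> foldr cons_red [::] s = s.
Proof.
elim: s => //= a s IH aP; have sP : reduced s by case: (s) aP => //= b s' /andP[].
rewrite IH //; case: s {IH sP} aP => //= b s /andP[ba _].
by rewrite (negPf ba).
Qed.

Definition word_inv (s : seq letter) : seq letter := rev (map letter_inv s).

Lemma reduced_word_inv s : reduced s -> reduced (word_inv s).
Proof.
rewrite /reduced /word_inv rev_sorted sorted_map; apply: sub_sorted => a b /=.
by rewrite letter_invK eq_sym.
Qed.

Lemma foldr_word_inv s t : reduced t ->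
  foldr cons_red (foldr cons_red t s) (word_inv s) = t.
Proof.
move=> tP; elim: s => //= a s IH.
rewrite /word_inv /= rev_cons foldr_rcons cons_redK ?reduced_foldr //.
Qed.

Definition fg_one : free_group := @FreeGroup [::] isT.
Definition fg_mul (s t : free_group) : free_group :=
  FreeGroup (reduced_foldr s (fg_reduced t)).
Definition fg_inv (s : free_group) : free_group :=
  FreeGroup (reduced_word_inv (fg_reduced s)).

Lemma fg_mulA : associative fg_mul.
Proof.
move=> [s sP] [t tP] [u uP]; apply: val_inj => /=.
elim: s {sP} => //= a s ->.
by rewrite foldr_cons_red // reduced_foldr.
Qed.

Lemma fg_mul1 : left_id fg_one fg_mul.
Proof. by move=> s; apply: val_inj. Qed.

Lemma fg_mulr1 : right_id fg_one fg_mul.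
Proof. by move=> [s sP]; apply: val_inj => /=; exact: foldr_cons_red_nil. Qed.

Lemma fg_mulV : left_inverse fg_one fg_inv fg_mul.
Proof.
move=> [s sP]; apply: val_inj => /=.
by rewrite -{1}(foldr_cons_red_nil sP) foldr_word_inv.
Qed.

Lemma fg_invK : involutive fg_inv.
Proof.
move=> [s sP]; apply: val_inj => /=.
by rewrite /word_inv map_rev revK mapK //; exact: letter_invK.
Qed.

Lemma fg_mulrV : right_inverse fg_one fg_inv fg_mul.
Proof. by move=> s; rewrite -{1}[s]fg_invK fg_mulV. Qed.

HB.instance Definition _ := isGroup.Build free_group
  fg_mulA fg_mul1 fg_mulr1 fg_mulV fg_mulrV.

Definition fg_gen (x : X) : free_group := @FreeGroup [:: (x, true)] isT.

Section UniversalProperty.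
Variables (G : groupType) (f : X -> G).

Definition letter_eval (a : letter) : G := if a.2 then f a.1 else (f a.1)^-1.

Definition fg_eval (s : free_group) : G :=
  foldr (fun a g => letter_eval a * g) 1 s.

Lemma letter_eval_inv a : letter_eval (letter_inv a) = (letter_eval a)^-1.
Proof. by case: a => x [] //=; rewrite /letter_eval /= invgK. Qed.

Lemma fg_eval_gen x : fg_eval (fg_gen x) = f x.
Proof. by rewrite /fg_eval /= mulg1. Qed.

Lemma fg_evalM : {morph fg_eval : s t / s * t}.
Proof.
move=> [s sP] [t tP]; rewrite /fg_eval /=.
elim: s {sP} => [|a s IH] /=; first by rewrite mul1g.
rewrite -mulgA -IH; case: (foldr cons_red t s) => //= b u.
by case: ifPn => [/eqP ->|//]; rewrite letter_eval_inv /= mulVKg.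
Qed.

Lemma fg_eval_unique (h : {multiplicative free_group -> G}) :
  (forall x, h (fg_gen x) = f x) -> h =1 fg_eval.
Proof.
move=> hf.
have h1 : h 1 = 1 by apply: (@mulgI _ (h 1)); rewrite -gmulfM !mulg1.
have hV x : h (fg_gen x)^-1 = (f x)^-1.
  by apply: (@mulgI _ (h (fg_gen x))); rewrite -gmulfM mulgV h1 hf mulgV.
move=> [s sP]; rewrite /fg_eval /=; elim: s sP => [|a s IH] sP /=.
  by rewrite -h1; congr (h _); exact: val_inj.
have s'P : reduced s by case: (s) sP => //= b s' /andP[].
rewrite -(IH s'P) {IH}.
have -> : FreeGroup sP = (if a.2 then fg_gen a.1 else (fg_gen a.1)^-1) * FreeGroup s'P.
  apply: val_inj; case: a sP => x [] sP /=;
  by case: s {s'P} sP => //= b s /andP[/negPf ->].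
by rewrite gmulfM /letter_eval; case: (a.2); rewrite ?hf ?hV.
Qed.

End UniversalProperty.
End FreeGroup.

Notation F2 := (free_group 'I_2).

(* The group of permutation matrices is ['S_n], embedded by [perm_mx], which   *)
(* is a morphism since (p * q) i = q (p i). The entries are 0 and 1, so the    *)
(* trace may be computed in any field of characteristic 0.                     *)
Section Permutations.
Variable R : numFieldType.

Definition ntr n (p : 'S_n) : R := (\tr (perm_mx p : 'M[R]_n) / n%:R)%R.

Definition dH n (p q : 'S_n) : R := (1 - ntr (p^-1 * q))%R.

Lemma trE n (p : 'S_n) : (\tr (perm_mx p : 'M[R]_n) = #|[set i | p i == i]|%:R)%R.
Proof.
rewrite /mxtrace -sum1_card natr_sum [RHS]big_mkcond /=; apply: eq_bigr => i _.
by rewrite !mxE inE; case: eqP.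
Qed.

Lemma ntrE n (p : 'S_n) : ntr p = (#|[set i | p i == i]|%:R / n%:R)%R.
Proof. by rewrite /ntr trE. Qed.

Lemma ntr_ge0 n (p : 'S_n) : (0 <= ntr p)%R.
Proof. by rewrite ntrE divr_ge0. Qed.

Lemma ntr_le1 n (p : 'S_n) : (ntr p <= 1)%R.
Proof.
case: n p => [|n] p; first by rewrite ntrE invr0 mulr0.
rewrite ntrE ler_pdivrMr ?ltr0n // mul1r ler_nat.
by rewrite (leq_trans (max_card _)) // card_ord.
Qed.

Lemma dHE n (p q : 'S_n) : (0 < n)%N ->
  dH p q = (#|[set i | p i != q i]|%:R / n%:R)%R.
Proof.
move=> n0; have nn0 : (n%:R != 0 :> R)%R by rewrite pnatr_eq0 -lt0n.
rewrite /dH ntrE -{1}(divff nn0) -mulrBl; congr (_ / _)%R.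
have -> : #|[set i | (p^-1 * q) i == i]| = #|[set i | p i == q i]|.
  rewrite -[RHS](card_preimset _ (@perm_inj _ p^-1)); apply: eq_card => i.
  by rewrite !inE permM permKV eq_sym.
have E : (#|[set i | p i == q i]| + #|~: [set i | p i == q i]|)%N = n.
  by rewrite cardsC card_ord.
rewrite -[X in (X%:R - _)%R]E natrD addrC addKr.
by congr (_%:R)%R; apply: eq_card => i; rewrite !inE.
Qed.

Lemma dH_ge0 n (p q : 'S_n) : (0 <= dH p q)%R.
Proof. by rewrite subr_ge0 ntr_le1. Qed.

Lemma dHxx n (p : 'S_n) : (0 < n)%N -> dH p p = 0%R.
Proof.
move=> n0; rewrite dHE // (_ : [set i | _] = finset.set0) ?cards0 ?mul0r //.
by apply/setP => i; rewrite !inE eqxx.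
Qed.

Lemma dHC n (p q : 'S_n) : (0 < n)%N -> dH p q = dH q p.
Proof.
by move=> n0; rewrite !dHE //; congr (_%:R / _)%R; apply: eq_card => i; rewrite !inE eq_sym.
Qed.

Lemma dH_triangle n (q p s : 'S_n) : (0 < n)%N -> (dH p s <= dH p q + dH q s)%R.
Proof.
move=> n0; rewrite !dHE // -mulrDl ler_wpM2r ?invr_ge0 // -natrD ler_nat.
apply: leq_trans (leq_card_setU _ _); apply: subset_leq_card.
apply/fintype.subsetP => i; rewrite !inE; apply: contraNT.
by rewrite negb_or !negbK => /andP[/eqP -> /eqP ->].
Qed.

Lemma dH_mull n (s p q : 'S_n) : dH (s * p) (s * q) = dH p q.
Proof. by rewrite /dH invMg -mulgA mulKg. Qed.

Lemma dH_mulr n (s p q : 'S_n) : (0 < n)%N -> dH (p * s) (q * s) = dH p q.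
Proof.
move=> n0; rewrite !dHE //; congr (_%:R / _)%R; apply: eq_card => i.
by rewrite !inE !permM (inj_eq (@perm_inj _ s)).
Qed.

Lemma dH_inv n (p q : 'S_n) : (0 < n)%N -> dH p^-1 q^-1 = dH p q.
Proof.
by move=> n0; rewrite -(dH_mull p) mulgV -(dH_mulr q) // mul1g mulgVK dHC.
Qed.

Lemma cast_perm_dH n m (e : n = m) (p q : 'S_n) :
  dH (cast_perm e p) (cast_perm e q) = dH p q.
Proof. by case: m / e; rewrite !cast_perm_id. Qed.

Lemma ntr_cast n m (e : n = m) (p : 'S_n) : ntr (cast_perm e p) = ntr p.
Proof. by case: m / e; rewrite !cast_perm_id. Qed.

Section Amplification.
Variables (n r : nat).

Lemma amp_perm_subproof (p : 'S_n) : injective (fun i : 'I_(n * r) =>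
  mxtens_index (p (mxtens_unindex i).1, (mxtens_unindex i).2)).
Proof.
move=> i j; case: (mxtens_indexP i) => i1 i2; case: (mxtens_indexP j) => j1 j2.
rewrite !mxtens_indexK => /(can_inj (@mxtens_indexK _ _)) /= [].
by move=> /perm_inj -> ->.
Qed.

Definition amp_perm (p : 'S_n) : 'S_(n * r) := perm (@amp_perm_subproof p).

Lemma amp_permE (p : 'S_n) i j :
  amp_perm p (mxtens_index (i, j)) = mxtens_index (p i, j).
Proof. by rewrite permE mxtens_indexK. Qed.

Lemma perm_mx_amp (p : 'S_n) :
  (perm_mx (amp_perm p) = perm_mx p *t (1%:M : 'M[R]_r))%R.
Proof.
apply/matrixP => i j; case: (mxtens_indexP i) => i1 i2; case: (mxtens_indexP j) => j1 j2.
rewrite tensmxE !mxE amp_permE (inj_eq (can_inj (@mxtens_indexK _ _))) xpair_eqE.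
by rewrite mulr_natl -mulrnA mulnb andbC.
Qed.

Lemma amp_permM (p q : 'S_n) : amp_perm (p * q) = amp_perm p * amp_perm q.
Proof.
by apply/permP => i; case: (mxtens_indexP i) => i1 i2; rewrite permM !amp_permE permM.
Qed.

Lemma amp_perm1 : amp_perm 1 = 1.
Proof. by apply/permP => i; case: (mxtens_indexP i) => i1 i2; rewrite amp_permE !perm1. Qed.

Lemma amp_permV (p : 'S_n) : amp_perm p^-1 = (amp_perm p)^-1.
Proof. by apply: (mulgI (amp_perm p)); rewrite -amp_permM !mulgV amp_perm1. Qed.

Lemma ntr_amp (p : 'S_n) : (0 < r)%N -> ntr (amp_perm p) = ntr p.
Proof.
move=> r0; have rn0 : (r%:R != 0 :> R)%R by rewrite pnatr_eq0 -lt0n.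
rewrite !ntrE natrM invfM mulrA [RHS]mulrC.
have -> : #|[set i | amp_perm p i == i]| = (#|[set i | p i == i]| * r)%N.
  transitivity #|finset.setX [set i | p i == i] [set: 'I_r]|; last first.
    by rewrite finset.cardsX finset.cardsT card_ord.
  rewrite -(card_imset _ (can_inj (@mxtens_indexK n r))).
  apply: eq_card => i; case: (mxtens_indexP i) => i1 i2.
  rewrite inE amp_permE (inj_eq (can_inj (@mxtens_indexK _ _))) xpair_eqE eqxx andbT.
  by rewrite mem_imset ?inE ?andbT //; exact: can_inj (@mxtens_indexK n r).
by rewrite natrM mulrAC mulfK // mulrC.
Qed.

Lemma dH_amp (p q : 'S_n) : (0 < r)%N -> dH (amp_perm p) (amp_perm q) = dH p q.
Proof. by move=> r0; rewrite /dH -amp_permV -amp_permM ntr_amp. Qed.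

End Amplification.

Lemma amp_cast n m r (e : n = m) (e' : (n * r = m * r)%N) (p : 'S_n) :
  amp_perm r (cast_perm e p) = cast_perm e' (amp_perm r p).
Proof.
by case: m / e e' => e'; rewrite !cast_perm_id.
Qed.

Lemma amp_castr n r s (e : r = s) (e' : (n * r = n * s)%N) (p : 'S_n) :
  amp_perm s p = cast_perm e' (amp_perm r p).
Proof. by case: s / e e' => e'; rewrite cast_perm_id. Qed.

Lemma amp_amp n r s (e : (n * r * s = n * (r * s))%N) (p : 'S_n) :
  cast_perm e (amp_perm s (amp_perm r p)) = amp_perm (r * s) p.
Proof.
apply/permP => i; rewrite cast_permE.
case: (mxtens_indexP i) => i1 i2; case: (mxtens_indexP i2) => i3 i4.
have E (j : 'I_n) : mxtens_index (j, mxtens_index (i3, i4)) =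
    cast_ord e (mxtens_index (mxtens_index (j, i3), i4)).
  by apply: val_inj => /=; rewrite mulnDl addnA mulnA.
by rewrite amp_permE !E cast_ordK !amp_permE.
Qed.

Section DirectSum.
Variables (n m : nat).

Definition dsum_fun (p : 'S_n) (q : 'S_m) (i : 'I_(n + m)) : 'I_(n + m) :=
  match fintype.split i with
  | inl j => lshift m (p j)
  | inr j => rshift n (q j)
  end.

Lemma dsum_funl p q i : dsum_fun p q (lshift m i) = lshift m (p i).
Proof. by rewrite /dsum_fun (unsplitK (inl i)). Qed.

Lemma dsum_funr p q i : dsum_fun p q (rshift n i) = rshift n (q i).
Proof. by rewrite /dsum_fun (unsplitK (inr i)). Qed.

Lemma dsum_perm_subproof p q : injective (dsum_fun p q).
Proof.
move=> i j; case: (split_ordP i) => i' ->; case: (split_ordP j) => j' ->;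
  rewrite ?(dsum_funl, dsum_funr) => /eqP; rewrite eq_shift //.
- by move=> /eqP/perm_inj ->.
- by move=> /eqP/perm_inj ->.
Qed.

Definition dsum_perm (p : 'S_n) (q : 'S_m) : 'S_(n + m) :=
  perm (@dsum_perm_subproof p q).

Lemma dsum_perml p q i : dsum_perm p q (lshift m i) = lshift m (p i).
Proof. by rewrite permE dsum_funl. Qed.

Lemma dsum_permr p q i : dsum_perm p q (rshift n i) = rshift n (q i).
Proof. by rewrite permE dsum_funr. Qed.

Lemma perm_mx_dsum p q :
  (perm_mx (dsum_perm p q) = block_mx (perm_mx p) 0 0 (perm_mx q) :> 'M[R]__)%R.
Proof.
apply/matrixP => i j; case: (split_ordP i) => i' ->; case: (split_ordP j) => j' ->;
rewrite ?(block_mxEul, block_mxEur, block_mxEdl, block_mxEdr) !mxE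
  ?(dsum_perml, dsum_permr) eq_shift //.
Qed.

Lemma dsum_permM p p' q q' :
  dsum_perm (p * p') (q * q') = dsum_perm p q * dsum_perm p' q'.
Proof.
by apply/permP => i; case: (split_ordP i) => i' ->;
  rewrite permM ?(dsum_perml, dsum_permr) permM.
Qed.

Lemma dsum_perm1 : dsum_perm 1 1 = 1.
Proof.
by apply/permP => i; case: (split_ordP i) => i' ->;
  rewrite ?(dsum_perml, dsum_permr) !perm1.
Qed.

Lemma dsum_permV p q : dsum_perm p^-1 q^-1 = (dsum_perm p q)^-1.
Proof. by apply: (mulgI (dsum_perm p q)); rewrite -dsum_permM !mulgV dsum_perm1. Qed.

Lemma ntr_dsum p q : (0 < n)%N -> (0 < m)%N ->
  (ntr (dsum_perm p q) = (n%:R / (n + m)%:R) * ntr p + (m%:R / (n + m)%:R) * ntr q)%R.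
Proof.
move=> n0 m0; rewrite /ntr perm_mx_dsum mxtrace_block mulrDl.
have H k : (0 < k)%N -> (k%:R != 0 :> R)%R by rewrite pnatr_eq0 -lt0n.
by congr (_ + _)%R; rewrite mulrACA [(_^-1 * _^-1)%R]mulrC mulrACA divff ?mul1r ?H.
Qed.

Lemma dH_dsum p q p' q' : (0 < n)%N -> (0 < m)%N ->
  (dH (dsum_perm p q) (dsum_perm p' q') <= dH p p' + dH q q')%R.
Proof.
move=> n0 m0; rewrite /dH -dsum_permV -dsum_permM ntr_dsum //.
set a := ntr _; set b := ntr _.
have nm0 : ((n + m)%:R != 0 :> R)%R by rewrite pnatr_eq0 -lt0n addn_gt0 n0.
have -> : (1 - (n%:R / (n + m)%:R * a + m%:R / (n + m)%:R * b) =
  n%:R / (n + m)%:R * (1 - a) + m%:R / (n + m)%:R * (1 - b))%R.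
  by rewrite natrD in nm0 *; field.
by apply: lerD; rewrite ler_piMl ?subr_ge0 ?ntr_le1 // ler_pdivrMr
  ?ltr0n ?addn_gt0 ?n0 // mul1r ler_nat ?leq_addr ?leq_addl.
Qed.

End DirectSum.
End Permutations.

Local Open Scope classical_set_scope.

(* [repr] alone is the representative of a set in a finite group. *)
Local Notation rep := generic_quotient.repr.

Record free_ultrafilter := FreeUltrafilter {
  fu_sets :> set_system nat;
  fu_ultra : UltraFilter fu_sets;
  fu_free : \bigcap_(A in fu_sets) A = set0 }.
#[global] Existing Instance fu_ultra.

(* Sequences of positive integers: dimensions n_k, amplifications r_k. *)
Record posseq := PosSeq {
  posseq_val :> nat -> nat;
  posseq_gt0 : forall k, (0 < posseq_val k)%N }.

Definition posseq_mul (n r : posseq) : posseq :=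
  @PosSeq (fun k => n k * r k)%N
    (fun k => etrans (muln_gt0 _ _) (introT andP (conj (posseq_gt0 n k) (posseq_gt0 r k)))).

Definition posseq_add (n m : posseq) : posseq :=
  @PosSeq (fun k => n k + m k)%N (fun k => ltn_addr _ (posseq_gt0 n k)).

Definition posseq1 : posseq := @PosSeq (fun=> 1%N) (fun=> isT).

Definition permseq (n : posseq) : Type := forall k, 'S_(n k).
HB.instance Definition _ n := gen_eqMixin (permseq n).
HB.instance Definition _ n := gen_choiceMixin (permseq n).

Section Ultraproduct.
Variables (R : realType) (w : free_ultrafilter).

Definition null_permseq (n : posseq) (p : permseq n) : Prop :=
  dH R (p k) 1 @[k --> fu_sets w] --> (0 : R)%R.

Definition permseq_eqv (n : posseq) : rel (permseq n) :=
  fun p q => `[< null_permseq (fun k => (p k)^-1 * q k : 'S_(n k)) >].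

Section Quotient.
Variable n : posseq.
Implicit Types p q s : permseq n.

Lemma permseq_eqvP p q :
  reflect (dH R (p k) (q k) @[k --> fu_sets w] --> (0 : R)%R) (permseq_eqv p q).
Proof.
suff E : (fun k => dH R ((p k)^-1 * q k) 1) = (fun k => dH R (p k) (q k)).
  by rewrite /permseq_eqv /null_permseq E; exact: asboolP.
apply/funext => k.
by rewrite -(dH_mull R (p k)) mulVKg mulg1 dHC // posseq_gt0.
Qed.

Lemma permseq_eqv_refl : reflexive (@permseq_eqv n).
Proof.
move=> p; apply/permseq_eqvP.
under eq_fun do rewrite dHxx ?posseq_gt0 //.
exact: cvg_cst.
Qed.

Lemma permseq_eqv_sym : symmetric (@permseq_eqv n).
Proof.
move=> p q; apply/permseq_eqvP/permseq_eqvP => H;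
by under eq_fun do rewrite dHC ?posseq_gt0 //.
Qed.

Lemma cvg0_squeeze (f g : nat -> R) : (forall k, 0 <= f k <= g k)%R ->
  g k @[k --> fu_sets w] --> (0 : R)%R -> f k @[k --> fu_sets w] --> (0 : R)%R.
Proof.
move=> fg g0; apply: (@squeeze_cvgr _ _ _ _ (fun=> 0%R) g) => //.
  by apply: nearW => k; exact: fg.
exact: cvg_cst.
Qed.

Lemma cvg0_add (f g : nat -> R) :
  f k @[k --> fu_sets w] --> (0 : R)%R -> g k @[k --> fu_sets w] --> (0 : R)%R ->
  (f k + g k)%R @[k --> fu_sets w] --> (0 : R)%R.
Proof. by move=> f0 g0; rewrite -[X in _ --> X]addr0; apply: cvgD. Qed.

Lemma permseq_eqv_trans : transitive (@permseq_eqv n).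
Proof.
move=> q p s /permseq_eqvP pq /permseq_eqvP qs; apply/permseq_eqvP.
apply: cvg0_squeeze (cvg0_add pq qs) => k.
by rewrite dH_ge0 dH_triangle // posseq_gt0.
Qed.

Canonical permseq_eqv_equiv :=
  EquivRel (@permseq_eqv n) permseq_eqv_refl permseq_eqv_sym permseq_eqv_trans.

Definition ultraprod : Type := {eq_quot (@permseq_eqv n)}.
HB.instance Definition _ := Choice.on ultraprod.
HB.instance Definition _ := EqQuotient.on ultraprod.

Definition upi p : ultraprod := \pi p.

Lemma upiP p q :
  upi p = upi q <-> dH R (p k) (q k) @[k --> fu_sets w] --> (0 : R)%R.
Proof.
split=> [/eqmodP/permseq_eqvP //|H]; apply/eqmodP; exact/permseq_eqvP.
Qed.

Lemma upiK (x : ultraprod) : upi (rep x) = x.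
Proof. exact: reprK. Qed.

Lemma dH_rep p : dH R (rep (upi p) k) (p k) @[k --> fu_sets w] --> (0 : R)%R.
Proof. by apply/upiP; rewrite upiK. Qed.

Definition up_one : ultraprod := upi (fun k => 1).
Definition up_inv (x : ultraprod) : ultraprod := upi (fun k => (rep x k)^-1).
Definition up_mul (x y : ultraprod) : ultraprod := upi (fun k => rep x k * rep y k).

Lemma upi_mul p q : up_mul (upi p) (upi q) = upi (fun k => p k * q k).
Proof.
apply/upiP; apply: cvg0_squeeze (cvg0_add (dH_rep p) (dH_rep q)) => k.
rewrite dH_ge0 (le_trans (dH_triangle R (p k * rep (upi q) k) _ _ _)) ?posseq_gt0 //.
by rewrite dH_mull dH_mulr ?posseq_gt0.
Qed.

Lemma upi_inv p : up_inv (upi p) = upi (fun k => (p k)^-1).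
Proof.
apply/upiP; apply: cvg0_squeeze (dH_rep p) => k.
by rewrite dH_ge0 dH_inv ?posseq_gt0 /=.
Qed.

Lemma up_mulA : associative up_mul.
Proof.
move=> x y z; rewrite -[x]upiK -[y]upiK -[z]upiK !upi_mul; congr upi.
by apply/functional_extensionality_dep => k; rewrite mulgA.
Qed.

Lemma up_mul1 : left_id up_one up_mul.
Proof.
move=> x; rewrite -[x]upiK upi_mul; congr upi.
by apply/functional_extensionality_dep => k; rewrite mul1g.
Qed.

Lemma up_mulr1 : right_id up_one up_mul.
Proof.
move=> x; rewrite -[x]upiK upi_mul; congr upi.
by apply/functional_extensionality_dep => k; rewrite mulg1.
Qed.

Lemma up_mulV : left_inverse up_one up_inv up_mul.
Proof.
move=> x; rewrite -[x]upiK upi_inv upi_mul; congr upi.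
by apply/functional_extensionality_dep => k; rewrite mulVg.
Qed.

Lemma up_mulrV : right_inverse up_one up_inv up_mul.
Proof.
move=> x; rewrite -[x]upiK upi_inv upi_mul; congr upi.
by apply/functional_extensionality_dep => k; rewrite mulgV.
Qed.

HB.instance Definition _ := isGroup.Build ultraprod
  up_mulA up_mul1 up_mulr1 up_mulV up_mulrV.

Lemma upiM p q : upi p * upi q = upi (fun k => p k * q k).
Proof. exact: upi_mul. Qed.

Lemma upiV p : (upi p)^-1 = upi (fun k => (p k)^-1).
Proof. exact: upi_inv. Qed.

Definition up_tr (x : ultraprod) : R := lim (ntr R (rep x k) @[k --> fu_sets w]).

Lemma cvg_unit_ultra (f : nat -> R) : (forall k, 0 <= f k <= 1)%R ->
  cvg (f k @[k --> fu_sets w]).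
Proof.
move=> f01.
have fU : UltraFilter (f k @[k --> fu_sets w]).
  split=> [|F FF sF]; first exact: fmap_proper_filter.
  apply/seteqP; split=> // A FA.
  have [//|nA] := in_ultra_setVsetC (f @^-1` A) (fu_ultra w).
  have /filter_ex[x [//]] : F (A `&` ~` A) by apply: filterI => //; exact: sF.
have := @segment_compact R 0%R 1%R; rewrite compact_ultra => /(_ _ fU)[|l [_ fl]].
  apply: (@filterS _ w _ setT) filterT => k _ /=; rewrite in_itv /=; exact: f01.
by apply/cvg_ex; exists l.
Qed.

Lemma cvg_ntr p : cvg (ntr R (p k) @[k --> fu_sets w]).
Proof. by apply: cvg_unit_ultra => k; rewrite ntr_ge0 ntr_le1. Qed.

Lemma ntr_dH m (p q : 'S_m) : (0 < m)%N -> (`|ntr R p - ntr R q| <= dH R p q)%R.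
Proof.
move=> m0.
have dtr (s : 'S_m) : ntr R s = (1 - dH R 1 s)%R :> R by rewrite /dH invg1 mul1g opprB addrCA subrr addr0.
rewrite !dtr ler_norml; have t1 := dH_triangle R p 1 q m0.
have t2 := dH_triangle R q 1 p m0; rewrite (dHC R q p m0) in t2.
by apply/andP; split; lra.
Qed.

Lemma up_trE p : up_tr (upi p) = lim (ntr R (p k) @[k --> fu_sets w]).
Proof.
apply: cvg_lim => //.
have H : (ntr R (rep (upi p) k) - ntr R (p k))%R @[k --> fu_sets w] --> (0 : R)%R.
  apply/norm_cvg0P; apply: cvg0_squeeze (dH_rep p) => k.
  by rewrite normr_ge0 ntr_dH // posseq_gt0.
rewrite -[X in _ --> X]add0r.
have -> : (fun k => ntr R (rep (upi p) k)) =
    (fun k => ntr R (rep (upi p) k) - ntr R (p k) + ntr R (p k))%R.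
  by apply/funext => k; rewrite subrK.
by apply: cvgD H _; exact: cvg_ntr.
Qed.

End Quotient.
End Ultraproduct.

Section Operations.
Variables (R : realType) (w : free_ultrafilter).
Local Notation up := (ultraprod R w).
Local Notation upi := (@upi R w _).

Definition up_amp n (r : posseq) (x : up n) : up (posseq_mul n r) :=
  upi (fun k => amp_perm (r k) (rep x k) : 'S_(posseq_mul n r k)).

Lemma up_ampE n (r : posseq) (p : permseq n) :
  up_amp r (upi p) = upi (fun k => amp_perm (r k) (p k) : 'S_(posseq_mul n r k)).
Proof.
apply/upiP; apply: cvg0_squeeze (dH_rep w p) => k.
by rewrite dH_ge0 dH_amp ?posseq_gt0 /=.
Qed.

Definition up_dsum n m (x : up n) (y : up m) : up (posseq_add n m) :=
  upi (fun k => dsum_perm (rep x k) (rep y k) : 'S_(posseq_add n m k)).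

Lemma up_dsumE n m (p : permseq n) (q : permseq m) :
  up_dsum (upi p) (upi q) =
  upi (fun k => dsum_perm (p k) (q k) : 'S_(posseq_add n m k)).
Proof.
apply/upiP; apply: cvg0_squeeze (cvg0_add (dH_rep w p) (dH_rep w q)) => k.
by rewrite dH_ge0 dH_dsum ?posseq_gt0.
Qed.

(* n_k r_k = m_k t_k is not a conversion, so elements have to be transported. *)
Definition up_cast (n m : posseq) (e : n =1 m) (x : up n) : up m :=
  upi (fun k => cast_perm (e k) (rep x k)).

Lemma up_castE (n m : posseq) (e : n =1 m) (p : permseq n) :
  up_cast e (upi p) = upi (fun k => cast_perm (e k) (p k)).
Proof.
apply/upiP; apply: cvg0_squeeze (dH_rep w p) => k.
by rewrite dH_ge0 cast_perm_dH /=.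
Qed.

Lemma up_ampM n r : {morph @up_amp n r : x y / x * y}.
Proof.
move=> x y; rewrite -[x]upiK -[y]upiK upiM !up_ampE upiM; congr upi.
by apply/functional_extensionality_dep => k; rewrite amp_permM.
Qed.

Lemma up_dsumM n m (x x' : up n) (y y' : up m) :
  up_dsum (x * x') (y * y') = up_dsum x y * up_dsum x' y'.
Proof.
rewrite -[x]upiK -[y]upiK -[x']upiK -[y']upiK.
rewrite [in LHS]upiM [in LHS]upiM !up_dsumE upiM; congr upi.
by apply/functional_extensionality_dep => k; rewrite dsum_permM.
Qed.

Lemma up_castM (n m : posseq) (e : n =1 m) : {morph up_cast e : x y / x * y}.
Proof.
move=> x y; rewrite -[x]upiK -[y]upiK upiM !up_castE upiM; congr upi.
by apply/functional_extensionality_dep => k; rewrite cast_perm_morphM.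
Qed.

Lemma up_ampV n r (x : up n) : up_amp r x^-1 = (up_amp r x)^-1.
Proof.
rewrite -[x]upiK upiV !up_ampE upiV; congr upi.
by apply/functional_extensionality_dep => k; rewrite amp_permV.
Qed.

Lemma up_castV (n m : posseq) (e : n =1 m) (x : up n) : up_cast e x^-1 = (up_cast e x)^-1.
Proof.
apply: (mulgI (up_cast e x)); rewrite -up_castM !mulgV -[1]/(upi _) up_castE; congr upi.
apply/functional_extensionality_dep => k.
by apply: (mulgI (cast_perm (e k) 1)); rewrite -cast_perm_morphM !mulg1.
Qed.

Lemma up_ampJ n r (x u : up n) : up_amp r (x ^ u) = up_amp r x ^ up_amp r u.
Proof. by rewrite /conjg !up_ampM up_ampV. Qed.

Lemma up_castJ (n m : posseq) (e : n =1 m) (x u : up n) :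
  up_cast e (x ^ u) = up_cast e x ^ up_cast e u.
Proof. by rewrite /conjg !up_castM up_castV. Qed.

Lemma up_cast_id (n : posseq) (e : n =1 n) (x : up n) : up_cast e x = x.
Proof.
rewrite -[x]upiK up_castE; congr upi.
by apply/functional_extensionality_dep => k; rewrite cast_perm_id.
Qed.

Lemma up_cast_comp (n m l : posseq) (e : n =1 m) (f : m =1 l) (x : up n) :
  up_cast f (up_cast e x) = up_cast (ftrans e f) x.
Proof.
rewrite -[x]upiK !up_castE; congr upi.
apply/functional_extensionality_dep => k; rewrite cast_perm_comp.
by congr cast_perm; exact: eq_irrelevance.
Qed.

Lemma up_castK (n m : posseq) (e : n =1 m) : cancel (up_cast e) (up_cast (fsym e)).
Proof. by move=> x; rewrite up_cast_comp up_cast_id. Qed.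

Lemma up_amp_cast (n m r : posseq) (e : n =1 m) (x : up n) :
  up_amp r (up_cast e x) =
  up_cast (fun k => congr1 (muln^~ (r k)) (e k) : posseq_mul n r k = posseq_mul m r k)
    (up_amp r x).
Proof.
rewrite -[x]upiK !(up_castE, up_ampE); congr upi.
apply/functional_extensionality_dep => k; exact: amp_cast.
Qed.

Lemma up_amp_castr n (r s : posseq) (e : r =1 s) (x : up n) :
  up_amp s x =
  up_cast (fun k => congr1 (muln (n k)) (e k) : posseq_mul n r k = posseq_mul n s k)
    (up_amp r x).
Proof.
rewrite -[x]upiK !(up_castE, up_ampE); congr upi.
apply/functional_extensionality_dep => k; exact: amp_castr.
Qed.

Lemma up_amp_amp n (r s : posseq) (x : up n) :
  up_cast (fun k => esym (mulnA _ _ _) :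
     posseq_mul (posseq_mul n r) s k = posseq_mul n (posseq_mul r s) k)
    (up_amp s (up_amp r x)) = up_amp (posseq_mul r s) x.
Proof.
rewrite -[x]upiK !(up_castE, up_ampE); congr upi.
apply/functional_extensionality_dep => k; exact: amp_amp.
Qed.

Lemma up_tr_amp n r (x : up n) : up_tr (up_amp r x) = up_tr x.
Proof.
rewrite -[x]upiK up_ampE !up_trE.
have -> // : (fun k => ntr R (amp_perm (r k) (rep x k))) = (fun k => ntr R (rep x k)).
by apply/funext => k; rewrite ntr_amp ?posseq_gt0.
Qed.

Lemma up_tr0P n (x : up n) :
  up_tr x = 0%R <-> ntr R (rep x k) @[k --> fu_sets w] --> (0 : R)%R.
Proof.
split=> [x0|H]; last exact: (cvg_lim (@norm_hausdorff _ _) H).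
by rewrite -x0; exact: cvg_ntr.
Qed.

Lemma up_tr_dsum0 n m (x : up n) (y : up m) :
  up_tr x = 0%R -> up_tr y = 0%R -> up_tr (up_dsum x y) = 0%R.
Proof.
move=> /up_tr0P x0 /up_tr0P y0; rewrite up_trE; apply: (cvg_lim (@norm_hausdorff _ _)).
apply: cvg0_squeeze (cvg0_add x0 y0) => k.
rewrite ntr_ge0 ntr_dsum ?posseq_gt0 //.
by apply: lerD; rewrite ler_piMl ?ntr_ge0 // ler_pdivrMr
  ?ltr0n ?addn_gt0 ?posseq_gt0 // mul1r ler_nat ?leq_addr ?leq_addl.
Qed.

End Operations.

Section Sofic.
Variables (R : realType) (w : free_ultrafilter) (G : groupType).

Record sofic_rep := SoficRep {
  sofic_dim : posseq;
  sofic_dim_cvg : sofic_dim k @[k --> \oo] --> \oo;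
  sofic_hom :> {multiplicative G -> ultraprod R w sofic_dim};
  sofic_tr0 : forall g : G, g != 1 -> up_tr (sofic_hom g) = 0%R }.

HB.instance Definition _ := gen_eqMixin sofic_rep.
HB.instance Definition _ := gen_choiceMixin sofic_rep.

Section Amp.
Variables (T : sofic_rep) (r : posseq).

Definition amp_hom (g : G) : ultraprod R w (posseq_mul (sofic_dim T) r) :=
  up_amp r (T g).

Lemma amp_homM : {morph amp_hom : g h / g * h}.
Proof. by move=> g h; rewrite /amp_hom gmulfM up_ampM. Qed.

HB.instance Definition _ := isMultiplicative.Build _ _ amp_hom amp_homM.

Lemma amp_dim_cvg : posseq_mul (sofic_dim T) r k @[k --> \oo] --> \oo.
Proof.
have H := @sofic_dim_cvg T; apply/cvgnyPge => A.
move/cvgnyPge: H => /(_ A); apply: filterS => k /= /leq_trans; apply.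
by rewrite leq_pmulr // posseq_gt0.
Qed.

Lemma amp_tr0 g : g != 1 -> up_tr (amp_hom g) = 0%R.
Proof. by move=> g1; rewrite up_tr_amp sofic_tr0. Qed.

Definition sofic_amp : sofic_rep := SoficRep amp_dim_cvg amp_tr0.

End Amp.

Section Dsum.
Variables T P : sofic_rep.

Definition dsum_hom (g : G) :
    ultraprod R w (posseq_add (sofic_dim T) (sofic_dim P)) :=
  up_dsum (T g) (P g).

Lemma dsum_homM : {morph dsum_hom : g h / g * h}.
Proof. by move=> g h; rewrite /dsum_hom !gmulfM up_dsumM. Qed.

HB.instance Definition _ := isMultiplicative.Build _ _ dsum_hom dsum_homM.

Lemma dsum_dim_cvg : posseq_add (sofic_dim T) (sofic_dim P) k @[k --> \oo] --> \oo.
Proof.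
have H := @sofic_dim_cvg T; apply/cvgnyPge => A.
move/cvgnyPge: H => /(_ A); apply: filterS => k /= /leq_trans; apply.
exact: leq_addr.
Qed.

Lemma dsum_tr0 g : g != 1 -> up_tr (dsum_hom g) = 0%R.
Proof. by move=> g1; rewrite up_tr_dsum0 ?sofic_tr0. Qed.

Definition sofic_dsum : sofic_rep := SoficRep dsum_dim_cvg dsum_tr0.

End Dsum.

Definition sofic_conj (T P : sofic_rep) : Prop :=
  exists (e : sofic_dim T =1 sofic_dim P) (u : ultraprod R w (sofic_dim P)),
    forall g : G, up_cast e (T g) = P g ^ u.

Definition sofic_equiv (T P : sofic_rep) : Prop :=
  exists r t : posseq, sofic_conj (sofic_amp T r) (sofic_amp P t).

Lemma sofic_conj_refl T : sofic_conj T T.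
Proof.
by exists (frefl _), 1 => g; rewrite up_cast_id conjg1.
Qed.

Lemma sofic_conj_sym T P : sofic_conj T P -> sofic_conj P T.
Proof.
case=> e [u H]; exists (fsym e), (up_cast (fsym e) u^-1) => g.
rewrite -[T g](up_castK e) H -up_castJ; congr up_cast.
by rewrite -conjgM mulgV conjg1.
Qed.

Lemma sofic_conj_trans T P S : sofic_conj T P -> sofic_conj P S -> sofic_conj T S.
Proof.
case=> e [u H] [f [v K]]; exists (ftrans e f), (v * up_cast f u) => g.
by rewrite -up_cast_comp H up_castJ K conjgM.
Qed.

Lemma sofic_conj_amp T P r : sofic_conj T P -> sofic_conj (sofic_amp T r) (sofic_amp P r).
Proof.
case=> e [u H]; exists (fun k => congr1 (muln^~ (r k)) (e k)), (up_amp r u) => g.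
by rewrite /= /amp_hom -up_ampJ -H up_amp_cast.
Qed.

Lemma sofic_conj_ampr T (r s : posseq) : r =1 s -> sofic_conj (sofic_amp T r) (sofic_amp T s).
Proof.
move=> e; exists (fun k => congr1 (muln (sofic_dim T k)) (e k)), 1 => g.
by rewrite conjg1 /= /amp_hom (up_amp_castr e).
Qed.

Lemma sofic_conj_amp_amp T r s :
  sofic_conj (sofic_amp (sofic_amp T r) s) (sofic_amp T (posseq_mul r s)).
Proof.
exists (fun k => esym (mulnA _ _ _)), 1 => g.
by rewrite conjg1 /= /amp_hom -up_amp_amp.
Qed.

Lemma sofic_equiv_refl T : sofic_equiv T T.
Proof. by exists posseq1, posseq1; exact: sofic_conj_refl. Qed.

Lemma sofic_equiv_sym T P : sofic_equiv T P -> sofic_equiv P T.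
Proof. by case=> r [t H]; exists t, r; exact: sofic_conj_sym. Qed.

Lemma sofic_equiv_trans T P S : sofic_equiv T P -> sofic_equiv P S -> sofic_equiv T S.
Proof.
case=> r1 [t1 H1] [r2 [t2 H2]]; exists (posseq_mul r1 r2), (posseq_mul t2 t1).
apply: sofic_conj_trans (sofic_conj_sym (sofic_conj_amp_amp _ _ _)) _.
apply: sofic_conj_trans (sofic_conj_amp r2 H1) _.
apply: sofic_conj_trans (sofic_conj_amp_amp _ _ _) _.
apply: sofic_conj_trans (sofic_conj_amp_amp _ _ _).
apply: sofic_conj_trans (sofic_conj_amp t1 H2).
apply: sofic_conj_trans (sofic_conj_sym (sofic_conj_amp_amp _ _ _)).
by apply: sofic_conj_ampr => k /=; rewrite mulnC.
Qed.

Definition sofic_eqv : rel sofic_rep := fun T P => `[< sofic_equiv T P >].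

Lemma sofic_eqv_refl : reflexive sofic_eqv.
Proof. by move=> T; apply/asboolP; exact: sofic_equiv_refl. Qed.

Lemma sofic_eqv_sym : symmetric sofic_eqv.
Proof. by move=> T P; apply/asboolP/asboolP; exact: sofic_equiv_sym. Qed.

Lemma sofic_eqv_trans : transitive sofic_eqv.
Proof.
by move=> P T S /asboolP H /asboolP K; apply/asboolP; exact: sofic_equiv_trans H K.
Qed.

Canonical sofic_eqv_equiv :=
  EquivRel sofic_eqv sofic_eqv_refl sofic_eqv_sym sofic_eqv_trans.

Definition Sof : Type := {eq_quot sofic_eqv}.
HB.instance Definition _ := Choice.on Sof.
HB.instance Definition _ := EqQuotient.on Sof.

Definition sofic_class (T : sofic_rep) : Sof := \pi T.

Lemma sofic_classP T P : sofic_class T = sofic_class P <-> sofic_equiv T P.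
Proof. by split=> [/eqmodP/asboolP //|H]; apply/eqmodP/asboolP. Qed.

Lemma sofic_class_surj (c : Sof) : exists T, c = sofic_class T.
Proof. by exists (rep c); rewrite /sofic_class reprK. Qed.

(* [convex_comb l c1 c2 c] reads c = l c1 + (1 - l) c2. It is relational: the  *)
(* class on the right does not depend on the representatives [T] and [P] nor   *)
(* on the amplifications [r] and [t].                                          *)
Definition convex_comb (l : R) (c1 c2 c : Sof) : Prop :=
  exists (T P : sofic_rep) (r t : posseq),
    [/\ c1 = sofic_class T, c2 = sofic_class P,
        ((sofic_dim T k * r k)%:R /
          (sofic_dim T k * r k + sofic_dim P k * t k)%:R)%R
          @[k --> fu_sets w] --> l
      & c = sofic_class (sofic_dsum (sofic_amp T r) (sofic_amp P t))].

Definition extreme_point (c : Sof) : Prop :=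
  forall (l : R) (c1 c2 : Sof), (0 < l < 1)%R ->
    convex_comb l c1 c2 c -> c1 = c /\ c2 = c.

End Sofic.

(* Main.v *)
Require Import Defs.
From HB Require Import structures.
From mathcomp Require Import all_boot all_order all_algebra all_fingroup.
From mathcomp Require Import zify ring lra mxtens.
From mathcomp Require Import all_classical all_reals all_analysis.

(* Let [F2] act on [Y * Q], where [Y] is a finite expander for two             *)
(* permutations and [Q] a finite group in which the images of the generators   *)
(* satisfy no short relation; [F2] acts on [Q] by right translations. The      *)
(* second factor makes the action asymptotically free, so that a sequence of   *)
(* such actions is a sofic representation.                                     *)
(* It is an extreme point. A summand of positive weight is an almost invariant *)
(* set [B] in an amplification of [Y * Q]; amplifying further, [B] has the     *)
(* cardinality of some [Y * Q * W0]. Left translations of [Q] and permutations *)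
(* of the amplifying factor commute with the action, and expansion of [Y]      *)
(* makes their action on almost invariant sets ergodic, so [B] can be moved    *)
(* piece by piece onto [Y * Q * W0]: the summand is equivalent to the whole.   *)
(* Conversely an equivalence gives an almost equivariant map from one model    *)
(* to the base [Y'] of the other. If [Y'] is at least twice as large as the    *)
(* first model, the image of the uniform measure is almost invariant and       *)
(* supported on half of [Y'], against expansion. Hence models with             *)
(* sufficiently different sizes are inequivalent, and a diagonal argument over *)
(* the sequences of sizes gives uncountably many classes.                      *)

Set Implicit Arguments.
Unset Strict Implicit.
Unset Printing Implicit Defensive.

Import Order.TTheory GRing.Theory Num.Theory.
Import numFieldNormedType.Exports.

(** * Random expanders *)

(** For every [f : nat -> nat] there is a representation [theta f]; its class is extreme
    ([theta_extreme]), and pointwise domination of sequences along [w] forces inequivalence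
    ([theta_separated]). By [sofic_equiv_map] and [map_sofic_equiv], an equivalence amounts to
    bijections between amplified finite models whose equivariance error on the two generators is
    negligible along [w], so both facts reduce to finite combinatorics with constants independent of
    the model.

    Expansion is used through the L1 Poincare inequality [two_gen_poincare], with constant [2 ^ 14]
    for all sizes. For extremality, [exists_overlap] shows that some left translate of one almost
    invariant set overlaps another about as much as independent sets would. Iterating it
    ([matching]) moves a set onto another of the same size up to a small remainder, at a cost
    depending only on the precision; [absorb] turns this into a near isomorphism, and [piece_equiv]
    lets the precision tend to infinity. For separation, [expander_no_small_image] forbids almost
    equivariant maps from a small model to a large base. *)

Section PermutationsInto.
Variable T : finType.
Implicit Types (A I : {set T}) (u : {perm T}).

Definition perms_into A I := [set u : {perm T} | u @: I \subset A]%SET.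

Lemma card_perms_into_step A I x : x \notin I ->
  (#|perms_into A (x |: I)| * (#|T| - #|I|) <= #|perms_into A I| * (#|A| - #|I|))%N.
Proof.
move=> xI.
pose S1 := [set p : {perm T} * T | (p.1 \in perms_into A (x |: I)) && (p.2 \notin p.1 @: I)]%SET.
pose S2 := [set p : {perm T} * T | (p.1 \in perms_into A I) && (p.2 \in A :\: p.1 @: I)]%SET.
have cardS (F : {set {perm T}}) (P : {perm T} -> {set T}) n :
    (forall u, u \in F -> #|P u| = n) ->
    #|[set p : {perm T} * T | (p.1 \in F) && (p.2 \in P p.1)]%SET| = (#|F| * n)%N.
  move=> HP; rewrite -sum1_card big_set /= -(pair_big_dep (mem F) (fun u => mem (P u)) (fun _ _ => 1%N)) /=.
  rewrite (eq_bigr (fun=> n)) ?sum_nat_const // => u uF.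
  by rewrite sum1_card HP.
have c1 : #|S1| = (#|perms_into A (x |: I)| * (#|T| - #|I|))%N.
  rewrite -(@cardS _ (fun u => ~: (u @: I))%SET).
    by apply: eq_card => p; rewrite !inE.
  move=> u _; rewrite finset.cardsCs finset.setCK card_imset //; exact: perm_inj.
have c2 : #|S2| = (#|perms_into A I| * (#|A| - #|I|))%N.
  rewrite -(@cardS _ (fun u => A :\: (u @: I))%SET).
    by apply: eq_card => p; rewrite !inE.
  move=> u; rewrite inE => uI; rewrite cardsD; have /finset.setIidPr -> := uI.
  rewrite card_imset //; exact: perm_inj.
rewrite -c1 -c2.
pose g (p : {perm T} * T) := ((p.1 * tperm (p.1 x) p.2)%g, p.1 x).
rewrite -(@card_in_imset _ _ g S1).
  apply/subset_leq_card/fintype.subsetP => _ /imsetP[[u y] + ->].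
  rewrite !inE /= => /andP[uA yI].
  have xIu : u x \notin u @: I by rewrite mem_imset //; exact: perm_inj.
  have E : ((u * tperm (u x) y)%g @: I = u @: I)%SET.
    apply: eq_in_imset => i iI; rewrite permM tpermD //.
      by apply: contraNneq xIu => ->; rewrite imset_f.
    by apply: contraNneq yI => ->; rewrite imset_f.
  rewrite E; rewrite imsetU1 finset.subUset finset.sub1set in uA.
  by case/andP: uA => -> ->; rewrite xIu.
move=> [u y] [v z] /=; rewrite !inE /= => _ _ [e1 e2].
have yz : y = z.
  have := congr1 (fun w : {perm T} => w x) e1; rewrite !permM !tpermL //.
rewrite -yz e2 in e1; congr pair => //.
by apply: (mulIg (tperm (v x) y)); rewrite e1.
Qed.

Lemma card_perms_into A I :
  (#|perms_into A I| * #|T| ^ #|I| <= #|{perm T}| * #|A| ^ #|I|)%N.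
Proof.
elim: {I}#|I| {-2}I (erefl #|I|) => [|m IH] I mI.
  by rewrite mI !expn0 !muln1; exact: max_card.
have [x xI] : {x | x \in I} by apply/sigW/card_gt0P; rewrite mI.
have mI' : #|I :\ x| = m by move: mI; rewrite (cardsD1 x) xI => -[].
have := @card_perms_into_step A (I :\ x) x; rewrite finset.setD1K // !inE eqxx => /(_ isT).
rewrite mI' mI; have := IH _ mI'; rewrite mI'.
have mT : (m < #|T|)%N by rewrite -mI; exact: max_card.
have sT : (#|A| <= #|T|)%N by exact: max_card.
move: #|perms_into A _| #|perms_into A _| #|A| #|T| #|{perm T}| mT sT => b a s N P mN sN H1 H2.
have H3 : (b * N <= a * s)%N.
  rewrite -(@leq_pmul2r (N - m)) ?subn_gt0 //.
  have : (a * (s - m) * N <= a * s * (N - m))%N.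
    rewrite -!mulnA leq_mul2l; apply/orP; right.
    by rewrite mulnBl mulnBr leq_sub2l // mulnC leq_mul2l sN orbT.
  apply: leq_trans; rewrite -mulnA [(N * _)%N]mulnC mulnA.
  by rewrite leq_mul2r H2 orbT.
rewrite expnS mulnA (leq_trans (leq_mul H3 (leqnn _))) //.
by rewrite mulnAC expnS [(s * _)%N]mulnC mulnA leq_mul2r H1 orbT.
Qed.

End PermutationsInto.

Section UnionBound.
Variables (R : realType) (T : finType).
Implicit Types (A I : {set T}) (u : {perm T}).
Local Open Scope ring_scope.

Lemma sum_subset_expr (y : R) A :
  \sum_(I : {set T} | I \subset A) y ^+ #|I| = (1 + y) ^+ #|A|.
Proof.
have -> : (1 + y) ^+ #|A| = \prod_(i : T) ((if i \in A then y else 0) + 1).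
  rewrite -prodr_const big_mkcond /=.
  by apply: eq_bigr => i _; case: ifP => // _; rewrite (add0r, addrC).
rewrite bigA_distr /= [RHS](bigID (fun I : {set T} => I \subset A)) /=.
rewrite [X in _ = _ + X]big1 ?addr0; last first.
  move=> I /subsetPn[i iI iA]; rewrite (bigD1 i) //= iI (negPf iA) mul0r //.
apply: eq_bigr => I IA; rewrite -prodr_const [LHS]big_mkcond /=; apply: eq_bigr => i _.
by case: ifP => // /(fintype.subsetP IA) ->.
Qed.

Definition leaving A u := [set x in A | u x \notin A]%SET.
Definition staying A u := [set x in A | u x \in A]%SET.

Lemma card_staying A u : (#|staying A u| + #|leaving A u|)%N = #|A|.
Proof.
rewrite -(cardsID (u @^-1: A)%SET A); congr (_ + _)%N; apply: eq_card => x;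
  by rewrite !inE // andbC.
Qed.

(** Expanding [z ^+ k] in powers of [z - 1] over subsets and using [card_perms_into], the
    exponential moment is at most that of [|A|] independent points, each staying with probability
    [|A| / |T|]. *)
Lemma sum_staying_expr (z : R) A : (0 < #|T|)%N -> 1 <= z ->
  \sum_u z ^+ #|staying A u| <=
  #|{perm T}|%:R * (1 + (z - 1) * (#|A|%:R / #|T|%:R)) ^+ #|A|.
Proof.
move=> T0 z1; have T0' : (0 < #|T|%:R :> R) by rewrite ltr0n.
rewrite -sum_subset_expr mulr_sumr.
have -> : \sum_u z ^+ #|staying A u| =
    \sum_u \sum_(I : {set T} | I \subset staying A u) (z - 1) ^+ #|I|.
  by apply: eq_bigr => u _; rewrite sum_subset_expr addrC subrK.
rewrite (exchange_big_dep (fun I : {set T} => I \subset A)) /=; last first.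
  by move=> u I _ /fintype.subset_trans; apply; apply/fintype.subsetP => x; rewrite inE => /andP[].
apply: ler_sum => I IA.
have -> : \sum_(u | I \subset staying A u) (z - 1) ^+ #|I| =
    #|perms_into A I|%:R * (z - 1) ^+ #|I|.
  rewrite sumr_const -[LHS]mulr_natl; congr (_%:R * _)%R; apply: eq_card => u; rewrite !inE.
  apply/idP/idP.
    move=> /fintype.subsetP H; apply/fintype.subsetP => _ /imsetP[x xI ->].
    by move/H: xI; rewrite inE => /andP[].
  move=> /fintype.subsetP H; apply/fintype.subsetP => x xI.
  by rewrite inE (fintype.subsetP IA) //= H // imset_f.
rewrite exprMn expr_div_n mulrCA [leLHS]mulrC ler_wpM2l ?exprn_ge0 ?subr_ge0 //.
by rewrite mulrA ler_pdivlMr ?exprn_gt0 // -!natrX -!natrM ler_nat card_perms_into.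
Qed.

(** A Chernoff bound: a bad tuple has more than [15 |A|] stays out of [16 |A|], and the exponential
    moment factorises over the 16 independent permutations. *)
Lemma card_bad_tuples (z : R) A : (0 < #|T|)%N -> 1 <= z ->
  #|[set t : {ffun 'I_16 -> {perm T}} | (\sum_i #|leaving A (t i)| < #|A|)%N]%SET|%:R
    * z ^+ (15 * #|A|) <=
  (#|{perm T}|%:R * (1 + (z - 1) * (#|A|%:R / #|T|%:R)) ^+ #|A|) ^+ 16.
Proof.
move=> T0 z1; have z0 : 0 <= z by apply: le_trans z1; exact: ler01.
apply: (@le_trans _ _ ((\sum_u z ^+ #|staying A u|) ^+ 16)); last first.
  rewrite lerXn2r ?nnegrE ?sum_staying_expr // ?sumr_ge0 // => [u _|].
    exact: exprn_ge0.
  apply: le_trans (sum_staying_expr A T0 z1); apply: sumr_ge0 => u _.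
  exact: exprn_ge0.
have -> : (\sum_u z ^+ #|staying A u|) ^+ 16 =
    \prod_(i < 16) \sum_u z ^+ #|staying A u| by rewrite prodr_const card_ord.
rewrite bigA_distr_bigA /= mulr_natl -sumr_const.
rewrite [leRHS](bigID (fun t : {ffun 'I_16 -> {perm T}} => (\sum_i #|leaving A (t i)| < #|A|)%N)) /=.
rewrite -[leLHS]addr0 lerD //; last first.
  by apply: sumr_ge0 => t _; apply: prodr_ge0 => i _; exact: exprn_ge0.
rewrite [leRHS](eq_bigl (mem [set t : {ffun 'I_16 -> {perm T}} | (\sum_i #|leaving A (t i)| < #|A|)%N]%SET)); last first.
  by move=> t; rewrite !inE.
apply: ler_sum => t; rewrite inE => tb.
rewrite prodrXr; apply: ler_weXn2l => //.
have : (\sum_i #|staying A (t i)| + \sum_i #|leaving A (t i)| = 16 * #|A|)%N.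
  rewrite -big_split /= (eq_bigr (fun=> #|A|)); first by rewrite sum_nat_const card_ord.
  by move=> i _; exact: card_staying.
by move: tb => /=; set a := bigop _ _ _; set b := bigop _ _ _; lia.
Qed.

(** For [s <= N] the left side is one term of the expansion of [(1 + s / N) ^ N], which is at most
    [e ^ s]; and [e <= 4] follows from [exp (- 1/2) >= 1/2]. *)
Lemma bin_expr_le N s : (0 < N)%N -> 'C(N, s)%:R * (s%:R / N%:R) ^+ s <= 4%:R ^+ s :> R.
Proof.
move=> N0; case: (ltnP N s) => sN; first by rewrite bin_small // mul0r exprn_ge0.
set p : R := s%:R / N%:R.
have p0 : 0 <= p by rewrite divr_ge0.
apply: (@le_trans _ _ ((1 + p) ^+ N)).
  rewrite addrC exprDn (bigD1 (Ordinal (n := N.+1) (m := N - s) _)) ?ltnS ?leq_subr //= => H.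
  rewrite expr1n mulr1 subKn // bin_sub // mulr_natl lerDl sumr_ge0 // => i _.
  by rewrite mulrn_wge0 // mulr_ge0 ?exprn_ge0.
apply: (@le_trans _ _ (expR p ^+ N)).
  rewrite lerXn2r ?nnegrE ?expR_ge0 ?expR_ge1Dx //; lra.
rewrite -expRM_natl /p mulrC divfK ?pnatr_eq0 -?lt0n // -[s%:R]mulr1 expRM_natl.
rewrite lerXn2r ?nnegrE ?expR_ge0 //.
have h1 := expR_ge1Dx (- 2^-1 : R).
have h2 : expR (- 2^-1) * expR (2^-1) = 1 :> R by rewrite -expRD addNr expR0.
have h3 : expR 1 = expR (2^-1) ^+ 2 :> R.
  by rewrite -expRM_natl divff // pnatr_eq0.
have h4 : expR (2^-1) <= 2 :> R.
  have h0 := expR_gt0 (2^-1 : R); nra.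
by rewrite h3; have h0 := expR_gt0 (2^-1 : R); nra.
Qed.

(** Here [p] is a density. Since [p (2 - p) <= 3/4], the left side is at most [16 (3/4) ^ 14]: this
    margin is why 16 permutations suffice. *)
Lemma small_power_le (p : R) : 0 <= p -> 2 * p <= 1 -> 4 * ((2 - p) ^+ 16 * p ^+ 14) <= 2^-1.
Proof.
move=> p0 p1.
have -> : (2 - p) ^+ 16 * p ^+ 14 = (2 - p) ^+ 2 * (p * (2 - p)) ^+ 14 by ring.
have h1 : 0 <= p * (2 - p) <= 3/4 by apply/andP; split; nra.
have h2 : 0 <= (2 - p) ^+ 2 <= 4 by apply/andP; split; nra.
case/andP: h1 => a0 a1; case/andP: h2 => b0 b1.
have : (p * (2 - p)) ^+ 14 <= (3/4) ^+ 14 by rewrite lerXn2r ?nnegrE //; lra.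
have : 0 <= (p * (2 - p)) ^+ 14 by exact: exprn_ge0.
move: ((p * (2 - p)) ^+ 14) ((2 - p)^+2) b0 b1 => x y y0 y1 x0 x1.
have : y * x <= 4 * (3/4) ^+ 14 by apply: ler_pM.
move: (y * x) => q; lra.
Qed.

Lemma card_bad_tuples_le A : (0 < #|A|)%N -> (2 * #|A| <= #|T|)%N ->
  #|[set t : {ffun 'I_16 -> {perm T}} | (\sum_i #|leaving A (t i)| < #|A|)%N]%SET|%:R
  * 'C(#|T|, #|A|)%:R <= #|{perm T}|%:R ^+ 16 * 2^-1 ^+ #|A| :> R.
Proof.
move=> A0 AT; have T0 : (0 < #|T|)%N by lia.
have a0 : (0 < #|A|%:R :> R) by rewrite ltr0n.
have t0 : (0 < #|T|%:R :> R) by rewrite ltr0n.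
have at2 : 2 * #|A|%:R <= #|T|%:R :> R by rewrite -natrM ler_nat.
(* The Chernoff parameter is the inverse density of [A], so that the base [1 + (z - 1) p] becomes
   [2 - p]. *)
pose z : R := #|T|%:R / #|A|%:R; pose p : R := #|A|%:R / #|T|%:R.
have z1 : 1 <= z by rewrite /z ler_pdivlMr // mul1r; lra.
have p0 : 0 < p by rewrite divr_gt0.
have zp : z * p = 1 by rewrite /z /p; field; rewrite !gt_eqF.
have p2 : 2 * p <= 1 by rewrite /p mulrA ler_pdivrMr // mul1r.
have := card_bad_tuples A T0 z1; rewrite -/p.
have -> : 1 + (z - 1) * p = 2 - p by rewrite mulrBl zp; ring.
have := bin_expr_le #|A| T0; rewrite -/p.
move: p p0 p2 zp => {}p p0 p2 zp.
set B := #|pred_of_set [set _ | _]%SET|; set C := 'C(_, _).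
move: B C => b c; set s := #|A|; set P := #|{perm T}|%:R; move=> hc hb.
have ps0 : 0 < p ^+ (15 * s) by rewrite exprn_gt0.
have hb' : b%:R <= P ^+ 16 * ((2 - p) ^+ 16 * p ^+ 15) ^+ s.
  have : b%:R * z ^+ (15 * s) * p ^+ (15 * s) <= (P * (2 - p) ^+ s) ^+ 16 * p ^+ (15 * s).
    by rewrite ler_wpM2r // ltW.
  rewrite -mulrA -exprMn zp expr1n mulr1 => /le_trans; apply.
  by rewrite (exprMn 16 P) -(exprM _ s 16) (exprMn s (_ ^+ 16)) -(exprM _ 16 s) -(exprM _ 15 s)
             [(s * 16)%N]mulnC mulrA lexx.
have q0 : 0 <= (2 - p) ^+ 16 * p ^+ 14 by rewrite mulr_ge0 ?exprn_ge0 //; lra.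
have P0 : 0 <= P ^+ 16 by rewrite exprn_ge0.
apply: (@le_trans _ _ (P ^+ 16 * ((2 - p) ^+ 16 * p ^+ 14) ^+ s * (c%:R * p ^+ s))).
  apply: le_trans (ler_wpM2r _ hb') _ => //.
  rewrite (exprSr p 14) (exprMn s (_ ^+ 16)) (exprMn s (p ^+ 14)) (exprMn s (_ ^+ 16) (p ^+ 14)).
  move: (_ ^+ s) (_ ^+ s) (_ ^+ s) => x1 x2 x3.
  rewrite le_eqVlt; apply/orP; left; apply/eqP; ring.
apply: le_trans (ler_wpM2l _ hc) _; first by rewrite mulr_ge0 // exprn_ge0.
have h := small_power_le (ltW p0) p2.
rewrite -mulrA ler_wpM2l // -(exprMn s (_ * _)) mulrC lerXn2r ?nnegrE ?invr_ge0 //.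
by rewrite mulr_ge0.
Qed.

End UnionBound.

Lemma sum_half_expr_lt1 (R : realType) n : (\sum_(1 <= s < n.+1) 2^-1 ^+ s < 1 :> R)%R.
Proof.
have -> : (\sum_(1 <= s < n.+1) 2^-1 ^+ s = 1 - 2^-1 ^+ n :> R)%R.
  elim: n => [|n IH]; first by rewrite big_geq // expr0 subrr.
  by rewrite big_nat_recr //= IH exprS; field.
by rewrite ltrBlDr ltrDl exprn_gt0 // invr_gt0 ltr0n.
Qed.

Definition expander (J T : finType) (t : J -> {perm T}) : Prop :=
  forall A : {set T}, (2 * #|A| <= #|T|)%N -> (#|A| <= \sum_j #|leaving A (t j)|)%N.

(* Random 16-tuples work, by a union bound over all sets [A].                  *)
Lemma exists_expander (R : realType) (T : finType) :
  exists t : 'I_16 -> {perm T}, expander t.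
Proof.
pose W := {ffun 'I_16 -> {perm T}}.
pose bad A := [set t : W | (\sum_i #|leaving A (t i)| < #|A|)%N]%SET.
pose ok (A : {set T}) := (0 < #|A|)%N && (2 * #|A| <= #|T|)%N.
suff [t Ht] : exists t : W, forall A, ok A -> t \notin bad A.
  exists t => A AT; case: (posnP #|A|) => [->//|A0].
  by have := Ht A; rewrite /ok A0 AT !inE -leqNgt => /(_ isT).
suff : (#|\bigcup_(A | ok A) bad A| < #|W|)%N.
  rewrite ltnNge => H; apply/not_existsP => Hn; move/negP: H; apply.
  apply/subset_leq_card/fintype.subsetP => t _.
  have /existsNP[A /not_implyP[okA /negP]] := Hn t; rewrite negbK => tA.
  by apply/finset.bigcupP; exists A.
have cU : (#|\bigcup_(A | ok A) bad A| <= \sum_(A | ok A) #|bad A|)%N.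
  elim/big_rec2: _ => [|A n U _ IH]; first by rewrite cards0.
  by rewrite (leq_trans (leq_card_setU _ _)) // leq_add2l.
apply: leq_ltn_trans cU _.
have P0 : (0 < #|{perm T}|%:R ^+ 16 :> R)%R.
  by rewrite exprn_gt0 // ltr0n; apply/card_gt0P; exists 1%g.
have cW : (#|W| = #|{perm T}| ^ 16)%N by rewrite card_ffun card_ord.
rewrite -(ltr_nat R) cW natrX natr_sum.
apply: (@le_lt_trans _ _ (#|{perm T}|%:R ^+ 16 *
    \sum_(1 <= s < #|T|.+1) 2^-1 ^+ s)%R); last by rewrite gtr_pMr // sum_half_expr_lt1.
rewrite mulr_sumr.
apply: (@le_trans _ _ (\sum_(A : {set T} | ok A)
    (#|{perm T}|%:R ^+ 16 * 2^-1 ^+ #|A| / 'C(#|T|, #|A|)%:R))%R).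
  apply: ler_sum => A /andP[A0 AT]; rewrite ler_pdivlMr; last first.
    by rewrite ltr0n bin_gt0 max_card.
  exact: card_bad_tuples_le.
rewrite (partition_big (fun A : {set T} => inord #|A| : 'I_#|T|.+1) predT) //=.
rewrite big_add1 /= big_mkord big_ord_recl /= [X in (X + _)%R]big1 ?add0r; last first.
  move=> A /andP[/andP[A0 _] /eqP/(congr1 val)/=]; rewrite inordK ?ltnS ?max_card //.
  by move=> E; rewrite E in A0.
apply: ler_sum => s _.
have sT : (s.+1 <= #|T|)%N by [].
apply: (@le_trans _ _ (\sum_(A : {set T} | #|A| == s.+1)
    (#|{perm T}|%:R ^+ 16 * 2^-1 ^+ s.+1 / 'C(#|T|, s.+1)%:R))%R).
  rewrite big_mkcond [leRHS]big_mkcond /=; apply: ler_sum => A _.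
  have c0 n : (0 <= #|{perm T}|%:R ^+ 16 * 2^-1 ^+ n / 'C(#|T|, n)%:R :> R)%R.
    by rewrite divr_ge0 // mulr_ge0 ?exprn_ge0 // ltW.
  case: ifP => [/andP[_ /eqP/(congr1 val)]|_]; last by case: ifP.
  by rewrite /= inordK ?ltnS ?max_card // => ->; rewrite eqxx.
rewrite sumr_const -[leLHS]mulr_natl.
have -> : #|[pred A : {set T} | #|A| == s.+1]| = 'C(#|T|, s.+1).
  by rewrite -card_draws; apply: eq_card => A; rewrite !inE.
by rewrite [leLHS]mulrC divfK ?lexx // pnatr_eq0 -lt0n bin_gt0.
Qed.

(** * Poincare inequalities *)

Section Poincare.
Local Open Scope nat_scope.

(** The distance [|a - b|]: truncation kills one of the two terms. *)
Definition ndist (a b : nat) : nat := (a - b) + (b - a).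

Lemma ndist_triangle b a c : ndist a c <= ndist a b + ndist b c.
Proof. rewrite /ndist; lia. Qed.

Lemma ndistC a b : ndist a b = ndist b a.
Proof. by rewrite /ndist addnC. Qed.

Definition edge_variation (J T : finType) (t : J -> {perm T}) (f : T -> nat) : nat :=
  \sum_j \sum_x ndist (f x) (f (t j x)).

Section Expander.
Variables (J T : finType) (t : J -> {perm T}).
Hypothesis expt : expander t.
Implicit Type f : T -> nat.

(* Induction on the height of [f], removing the bottom layer: this is the      *)
(* co-area formula.                                                            *)
Lemma expander_sum_le f : 2 * #|[set x | 0 < f x]%SET| <= #|T| ->
  \sum_x f x <= \sum_j \sum_x (f x - f (t j x)).
Proof.
have [n] : exists n, forall x, f x <= n.
  by exists (\max_x f x) => x; exact: leq_bigmax.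
elim: n f => [|n IH] f fn fT.
  by rewrite big1 // => x _; apply/eqP; rewrite -leqn0.
pose A := [set x | 0 < f x]%SET; pose g x := (f x).-1.
have gn x : g x <= n by rewrite /g; have := fn x; case: (f x).
have gT : 2 * #|[set x | 0 < g x]%SET| <= #|T|.
  apply: leq_trans fT; rewrite leq_mul2l /=; apply/subset_leq_card/fintype.subsetP => x.
  by rewrite !inE /g; case: (f x).
have E : \sum_x f x = #|A| + \sum_x g x.
  rewrite -sum1_card [X in X + _]big_mkcond /= -big_split /=; apply: eq_bigr => x _.
  by rewrite inE /g; case: (f x).
have F j : \sum_x (f x - f (t j x)) = #|leaving A (t j)| + \sum_x (g x - g (t j x)).
  rewrite -sum1_card [X in X + _]big_mkcond /= -big_split /=; apply: eq_bigr => x _.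
  by rewrite !inE /g -leqNgt; case: (f x) => [|a]; case: (f (t j x)) => [|b] //=; lia.
by rewrite E (eq_bigr _ (fun j _ => F j)) big_split /= leq_add ?IH // expt.
Qed.

Lemma expander_sum_le_variation f : 2 * #|[set x | 0 < f x]%SET| <= #|T| ->
  \sum_x ndist (f x) 0 <= edge_variation t f.
Proof.
move=> /expander_sum_le H; apply: leq_trans (leq_trans H _).
  by apply: leq_sum => x _; rewrite /ndist; lia.
by apply: leq_sum => j _; apply: leq_sum => x _; rewrite leq_addr.
Qed.

Lemma median f : exists m,
  2 * #|[set x | m < f x]%SET| <= #|T| /\ 2 * #|[set x | f x < m]%SET| <= #|T|.
Proof.
pose P m := 2 * #|[set x | m < f x]%SET| <= #|T|.
have exP : exists m, P m.
  exists (\max_x f x); rewrite /P (_ : [set x | _]%SET = finset.set0) ?cards0 //.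
  by apply/setP => x; rewrite !inE ltnNge leq_bigmax.
(* Take the least [m] with at most half of the points strictly above it; minimality bounds the
   points below. *)
exists (ex_minn exP); case: ex_minnP => m Pm mmin; split => //.
case: m Pm mmin => [|m] Pm mmin.
  by rewrite (_ : [set x | _]%SET = finset.set0) ?cards0 //; apply/setP => x; rewrite !inE.
have : ~~ P m by apply/negP => /mmin; rewrite ltnn.
rewrite /P; have := cardsC [set x | m < f x]%SET.
have -> : (~: [set x | m < f x] = [set x | f x < m.+1])%SET.
  by apply/setP => x; rewrite !inE -leqNgt ltnS.
lia.
Qed.

(** Centred at a median, the positive and negative parts of [f] each live on at most half of the
    points, so [expander_sum_le] applies to both. *)
Lemma expander_poincare f : exists m, \sum_x ndist (f x) m <= edge_variation t f.
Proof.
have [m [m1 m2]] := median f; exists m.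
rewrite /ndist big_split /= /edge_variation.
have h1 := @expander_sum_le (fun x => f x - m).
have h2 := @expander_sum_le (fun x => m - f x).
apply: leq_trans (leq_add (h1 _) (h2 _)) _.
- by apply: leq_trans m1; rewrite leq_mul2l /=; apply/subset_leq_card/fintype.subsetP => x; rewrite !inE subn_gt0.
- by apply: leq_trans m2; rewrite leq_mul2l /=; apply/subset_leq_card/fintype.subsetP => x; rewrite !inE subn_gt0.
rewrite -big_split /=; apply: leq_sum => j _; rewrite -big_split /=.
by apply: leq_sum => x _; rewrite /ndist; lia.
Qed.

End Expander.

Section TwoGenerators.
Variables (T : finType) (t : 'I_16 -> {perm T}).

Lemma shift_inj : injective (fun y : T * 'I_16 => (y.1, (y.2 + 1)%R)).
Proof. by move=> [x i] [x' i'] e; have /= /addIr -> := congr1 snd e; have /= -> := congr1 fst e. Qed.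

Lemma twist_inj : injective (fun y : T * 'I_16 => (t y.2 y.1, y.2)).
Proof.
by move=> [x i] [x' i'] e; have := congr1 fst e; have /= -> := congr1 snd e => /perm_inj ->.
Qed.

(* Shifting the layers and applying [t i] on layer [i]: two permutations do    *)
(* the work of 16.                                                             *)
Definition two_gen (j : 'I_2) : {perm T * 'I_16} :=
  if j == ord0 then perm shift_inj else perm twist_inj.

Variable f : T * 'I_16 -> nat.
Let va := \sum_y ndist (f y) (f (two_gen ord0 y)).
Let vb := \sum_y ndist (f y) (f (two_gen ord_max y)).

Let variationE : edge_variation two_gen f = va + vb.
Proof.
rewrite /edge_variation big_ord_recl big_ord_recl big_ord0 addn0.
by congr (_ + _); apply: eq_bigr => y _; congr (ndist _ (f (two_gen _ y))); apply: val_inj.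
Qed.

Let vaE : va = \sum_i \sum_x ndist (f (x, i)) (f (x, (i + 1)%R)).
Proof.
rewrite exchange_big pair_big /=; apply: eq_bigr => [[x i] _].
by rewrite /two_gen eqxx permE.
Qed.

Let vbE : vb = \sum_i \sum_x ndist (f (x, i)) (f (t i x, i)).
Proof.
rewrite exchange_big pair_big /=; apply: eq_bigr => [[x i] _].
by rewrite /two_gen permE.
Qed.

(** Layer [i] is reached from layer 0 by at most 15 shifts, each costing at most [va]. *)
Let layer_dist i : \sum_x ndist (f (x, 0%R)) (f (x, i)) <= 16 * va.
Proof.
suff H k : k < 16 -> \sum_x ndist (f (x, 0%R)) (f (x, inord k)) <= k * va.
  by rewrite -[i]inord_val (leq_trans (H _ _)) // leq_mul2r ltnW ?orbT.
elim: k => [|k IH] k16.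
  have -> : inord 0 = 0%R :> 'I_16 by apply: val_inj; rewrite /= inordK.
  by rewrite big1 // => x _; rewrite /ndist subnn.
have e : inord k.+1 = (inord k + 1)%R :> 'I_16.
  by apply: val_inj => /=; rewrite !inordK // 1?ltnW // modn_small ?addn1.
apply: (@leq_trans (\sum_x (ndist (f (x, 0%R)) (f (x, inord k)) +
   ndist (f (x, inord k)) (f (x, (inord k + 1)%R))))).
  by apply: leq_sum => x _; rewrite e; exact: ndist_triangle.
rewrite big_split /= mulSn addnC leq_add //; last by apply: IH; exact: ltnW.
rewrite vaE [leqRHS](bigD1 (inord k)) //=; exact: leq_addr.
Qed.

(** On layer 0, [t i] is simulated by moving to layer [i], applying it there and moving back, so its
    total variation is at most [2^9 va + vb]. Comparing each of the 16 layers with layer 0 then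
    costs at most [16 (16 + 2^9) va + 16 vb], which is below [2^14 (va + vb)]. *)
Lemma two_gen_variation m :
  \sum_x ndist (f (x, 0%R)) m <= edge_variation t (fun x => f (x, 0%R)) ->
  \sum_y ndist (f y) m <= 2 ^ 14 * edge_variation two_gen f.
Proof.
move=> H.
have K1 : edge_variation t (fun x => f (x, 0%R)) <= 2 ^ 9 * va + vb.
  rewrite /edge_variation.
  apply: (@leq_trans (\sum_i (16 * va + \sum_x ndist (f (x, i)) (f (t i x, i)) + 16 * va))).
    apply: leq_sum => i _.
    have e := layer_dist i.
    have e' : \sum_x ndist (f (t i x, i)) (f (t i x, 0%R)) <= 16 * va.
      rewrite -(reindex_inj (@perm_inj _ (t i)) (P := predT) (F := fun x => ndist (f (x, i)) (f (x, 0%R)))) /=.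
      by apply: leq_trans e; apply: leq_sum => x _; rewrite ndistC.
    apply: leq_trans (leq_add (leq_add e (leqnn _)) e').
    rewrite -!big_split /=; apply: leq_sum => x _.
    apply: leq_trans (ndist_triangle (f (t i x, i)) _ _) _; rewrite leq_add2r.
    exact: ndist_triangle.
  rewrite big_split /= big_split /= -vbE !sum_nat_const card_ord.
  lia.
have K2 : \sum_y ndist (f y) m <= \sum_(i < 16) (16 * va + (2 ^ 9 * va + vb)).
  have -> : \sum_y ndist (f y) m = \sum_i \sum_x ndist (f (x, i)) m.
    by rewrite exchange_big pair_big /=; apply: eq_bigr => [[x i] _].
  apply: leq_sum => i _; apply: leq_trans (leq_add (layer_dist i) (leq_trans H K1)).
  rewrite -big_split /=; apply: leq_sum => x _.
  by rewrite (ndistC (f (x, 0%R)) (f (x, i))) ndist_triangle.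
apply: leq_trans K2 _; rewrite sum_nat_const card_ord variationE.
lia.
Qed.

End TwoGenerators.

Lemma two_gen_poincare (T : finType) (t : 'I_16 -> {perm T}) (f : T * 'I_16 -> nat) :
  expander t -> exists m, \sum_y ndist (f y) m <= 2 ^ 14 * edge_variation (two_gen t) f.
Proof.
move=> expt; have [m Hm] := expander_poincare expt (fun x => f (x, 0%R)).
by exists m; exact: two_gen_variation.
Qed.

Lemma two_gen_sum_le (T : finType) (t : 'I_16 -> {perm T}) (f : T * 'I_16 -> nat) :
  expander t -> 2 * #|[set y | 0 < f y]%SET| <= #|T| ->
  \sum_y f y <= 2 ^ 14 * edge_variation (two_gen t) f.
Proof.
move=> expt fT; apply: leq_trans (@two_gen_variation _ t f 0 _).
  by apply: leq_sum => y _; rewrite /ndist; lia.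
apply: expander_sum_le_variation => //; apply: leq_trans fT; rewrite leq_mul2l /=.
rewrite -(card_in_imset (f := fun x => (x, 0%R : 'I_16))); last by move=> x y _ _ [].
apply/subset_leq_card/fintype.subsetP => _ /imsetP[x + ->]; by rewrite !inE.
Qed.

End Poincare.

(** * Matching almost invariant sets *)

Section Boundary.
Local Open Scope nat_scope.
Variables (J Z : finType) (t : J -> {perm Z}).
Implicit Types (A B C D : {set Z}) (phi : Z -> Z).

Definition boundary A := \sum_j #|leaving A (t j)|.

Lemma card_leavingC A (u : {perm Z}) : #|leaving (~: A)%SET u| = #|leaving A u|.
Proof.
have h1 := card_staying A u.
have h2 := cardsID A (u @^-1: A)%SET.
have h3 := card_preimset A (@perm_inj _ u).
have e1 : (u @^-1: A :&: A = staying A u)%SET by apply/setP => x; rewrite !inE andbC.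
have e2 : (u @^-1: A :\: A = leaving (~: A) u)%SET.
  by apply/setP => x; rewrite !inE negbK.
rewrite e1 e2 in h2; lia.
Qed.

Lemma boundaryC A : boundary (~: A)%SET = boundary A.
Proof. by apply: eq_bigr => j _; exact: card_leavingC. Qed.

Lemma boundaryI A B : boundary (A :&: B)%SET <= boundary A + boundary B.
Proof.
rewrite -big_split /=; apply: leq_sum => j _.
apply: leq_trans (leq_card_setU _ _); apply/subset_leq_card/fintype.subsetP => x.
by rewrite !inE; case: (x \in A); case: (x \in B); case: (t j x \in A); case: (t j x \in B).
Qed.

Lemma boundaryD A B : boundary (A :\: B)%SET <= boundary A + boundary B.
Proof. by rewrite finset.setDE (leq_trans (boundaryI _ _)) // boundaryC. Qed.

Lemma boundary_preim (u : {perm Z}) A : (forall j x, t j (u x) = u (t j x)) ->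
  boundary (u @^-1: A)%SET = boundary A.
Proof.
move=> ut; apply: eq_bigr => j _; rewrite -[RHS](card_preimset _ (@perm_inj _ u)).
by apply: eq_card => x; rewrite !inE ut.
Qed.

(** [phi] is regarded as a partial map with domain [D], so leaving [D] counts as a failure of
    equivariance. *)
Definition defect phi D :=
  \sum_j #|[set z in D | ~~ ((t j z \in D) && (phi (t j z) == t j (phi z)))]%SET|.

End Boundary.

Section Matching.
Local Open Scope nat_scope.
Variables (Y : finType) (V : finGroupType) (s : 'I_2 -> {perm Y}) (c : 'I_2 -> V) (K : nat).
Hypothesis poincare : forall f : Y -> nat, exists m, \sum_y ndist (f y) m <= K * edge_variation s f.

Lemma skew_perm_inj j : injective (fun z : Y * V => (s j z.1, (z.2 * c j)%g)).
Proof.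
move=> [y v] [y' v'] e; have /= /perm_inj -> := congr1 fst e.
by have /= /mulIg -> := congr1 snd e.
Qed.

Definition skew_perm j : {perm Y * V} := perm (@skew_perm_inj j).

Lemma skew_permE j z : skew_perm j z = (s j z.1, (z.2 * c j)%g).
Proof. by rewrite permE. Qed.

Lemma ltrans_inj h : injective (fun z : Y * V => (z.1, (h * z.2)%g)).
Proof.
move=> [y v] [y' v'] e; have /= -> := congr1 fst e.
by have /= /mulgI -> := congr1 snd e.
Qed.

Definition ltrans h : {perm Y * V} := perm (@ltrans_inj h).

Lemma ltransE h z : ltrans h z = (z.1, (h * z.2)%g).
Proof. by rewrite permE. Qed.

Lemma skew_ltrans h j z : skew_perm j (ltrans h z) = ltrans h (skew_perm j z).
Proof. by rewrite !skew_permE !ltransE /= mulgA. Qed.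

Definition fibre (B : {set Y * V}) (y : Y) := #|[set v | (y, v) \in B]%SET|.

Lemma sum_fibre (B : {set Y * V}) : \sum_y fibre B y = #|B|.
Proof.
transitivity (\sum_y \sum_v if (y, v) \in B then 1 else 0).
  apply: eq_bigr => y _; rewrite /fibre -sum1_card big_mkcond /=.
  by apply: eq_bigr => v _; rewrite inE.
by rewrite pair_bigA /= -sum1_card [RHS]big_mkcond /=; apply: eq_bigr => -[y v] _.
Qed.

Lemma fibre_le (B : {set Y * V}) y : fibre B y <= #|V|.
Proof. exact: max_card. Qed.

(** For fixed [y], every pair of points in the fibres of [B] and [C] is related by exactly one
    [h]. *)
Lemma sum_ltransI (B C : {set Y * V}) :
  \sum_h #|(B :&: ltrans h @^-1: C)%SET| = \sum_y fibre B y * fibre C y.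
Proof.
transitivity (\sum_h \sum_y \sum_v ((y, v) \in B) * ((y, (h * v)%g) \in C)).
  apply: eq_bigr => h _.
  rewrite pair_bigA /= -sum1_card big_mkcond /=; apply: eq_bigr => -[y v] _ /=.
  by rewrite !inE ltransE /=; case: (_ \in B); case: (_ \in C).
rewrite exchange_big /=; apply: eq_bigr => y _.
rewrite exchange_big /= /fibre -[#|[set v | (y, v) \in B]%SET|]sum1_card big_distrl /=.
rewrite [RHS]big_mkcond /=; apply: eq_bigr => v _; rewrite -big_distrr /= inE.
case: (_ \in B); rewrite ?mul0n // !mul1n.
rewrite (reindex_inj (mulIg (v^-1)%g)) /= -sum1_card [RHS]big_mkcond /=; apply: eq_bigr => h _.
by rewrite mulgKV inE; case: (_ \in C).
Qed.

(** Fibre counts change by the points entering or leaving [B]; by [card_leavingC] both kinds are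
    equally many in total, whence the factor 2. *)
Lemma fibre_variation (B : {set Y * V}) : edge_variation s (fibre B) <= 2 * boundary skew_perm B.
Proof.
rewrite /edge_variation /boundary big_distrr /=; apply: leq_sum => j _.
rewrite mul2n -addnn -{2}card_leavingC -!sum_fibre -big_split /=; apply: leq_sum => y _.
have e1 : fibre B (s j y) = #|[set v | skew_perm j (y, v) \in B]%SET|.
  rewrite /fibre -[LHS](card_preimset _ (mulIg (c j))); apply: eq_card => v.
  by rewrite !inE skew_permE.
have h1 := cardsID [set v | skew_perm j (y, v) \in B]%SET [set v | (y, v) \in B]%SET.
have h2 := cardsID [set v | (y, v) \in B]%SET [set v | skew_perm j (y, v) \in B]%SET.
rewrite finset.setIC in h2.
have e2 : fibre (leaving B (skew_perm j)) y =
    #|([set v | (y, v) \in B] :\: [set v | skew_perm j (y, v) \in B])%SET|.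
  by apply: eq_card => v; rewrite !inE andbC.
have e3 : fibre (leaving (~: B)%SET (skew_perm j)) y =
    #|([set v | skew_perm j (y, v) \in B] :\: [set v | (y, v) \in B])%SET|.
  by apply: eq_card => v; rewrite !inE negbK.
rewrite e1 e2 e3 /ndist /fibre -h1 -h2; lia.
Qed.

(** Ergodicity of left translations: by the Poincare inequality the fibre counts of [B] are L1-close
    to a constant [m], so the overlap averaged over [h] is close to [|B| |C| / |Y * V|], and the
    best [h] does at least as well. Replacing [|B|] by [|Y| m] and the fibre counts by [m] each
    costs [2 K] times the boundary. *)
Lemma exists_overlap (B C : {set Y * V}) : exists h : V,
  #|B| * #|C| <= #|{: Y * V}| * (#|(B :&: ltrans h @^-1: C)%SET| + 4 * K * boundary skew_perm B).
Proof.
have [h hmax] : exists h : V, forall h', #|(B :&: ltrans h' @^-1: C)%SET| <= #|(B :&: ltrans h @^-1: C)%SET|.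
  by case: (@arg_maxnP V 1%g predT (fun h => #|(B :&: ltrans h @^-1: C)%SET|)) => // h _ H; exists h => h'; exact: H.
exists h; set M := #|(B :&: _)%SET|; set e := boundary _ _.
have [m Hm] := poincare (fibre B).
have Hm' : \sum_y ndist (fibre B y) m <= 2 * K * e.
  by rewrite (leq_trans Hm) // -mulnA mulnCA leq_mul2l fibre_variation orbT.
have s1 : \sum_y fibre B y * fibre C y <= #|V| * M.
  by rewrite -sum_ltransI -sum_nat_const; apply: leq_sum => h' _; exact: hmax.
have s2 : #|B| <= #|Y| * m + 2 * K * e.
  rewrite -sum_fibre (leq_trans _ (leq_add (leqnn _) Hm')) // -sum_nat_const -big_split /=.
  by apply: leq_sum => y _; rewrite /ndist; lia.
have s3 : m * #|C| <= #|V| * M + #|V| * (2 * K * e).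
  apply: leq_trans (leq_add s1 (leq_mul (leqnn _) Hm')).
  rewrite -sum_fibre !big_distrr /= -big_split /=; apply: leq_sum => y _.
  have := fibre_le C y; move: (fibre C y) (fibre B y) => x b xV.
  apply: (@leq_trans (b * x + x * ndist b m)); last by rewrite leq_add2l leq_mul2r xV orbT.
  by rewrite /ndist; nia.
have s4 : #|C| <= #|Y| * #|V| by rewrite -card_prod; exact: max_card.
rewrite card_prod.
apply: leq_trans (leq_mul s2 (leqnn _)) _; rewrite mulnDl -mulnA.
apply: leq_trans (leq_add (leq_mul (leqnn _) s3) (leq_mul (leqnn _) s4)) _.
by rewrite leq_eqVlt; apply/orP; left; apply/eqP; ring.
Qed.

(* Greedily move the largest possible part of [B] into [C] by a translation.   *)
Lemma greedy_matching a g n (B C : {set Y * V}) e : #|B| = #|C| ->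
  boundary skew_perm B + boundary skew_perm C <= e ->
  #|{: Y * V}| * (g + 4 * K * (2 ^ n * e)) <= a * a ->
  exists (phi : Y * V -> Y * V) (D : {set Y * V}),
    [/\ D \subset B, {in D &, injective phi}, {in D, forall z, phi z \in C},
        defect skew_perm phi D + e <= 2 ^ n * e
      & (#|B :\: D| <= a) \/ (n * g <= #|D|)].
Proof.
(* The stopping cases, where nothing is moved. *)
have trivial (B' C' : {set Y * V}) n' e' : (#|B'| <= a) \/ (n' = 0) ->
  exists (phi : Y * V -> Y * V) (D : {set Y * V}),
    [/\ D \subset B', {in D &, injective phi}, {in D, forall z, phi z \in C'},
        defect skew_perm phi D + e' <= 2 ^ n' * e'
      & (#|B' :\: D| <= a) \/ (n' * g <= #|D|)].
  move=> H; exists id, finset.set0; split.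
  - exact: finset.sub0set.
  - by move=> x y; rewrite inE.
  - by move=> x; rewrite inE.
  - rewrite /defect big1 ?add0n ?leq_pmull ?expn_gt0 // => j _.
    by rewrite (_ : [set z in _ | _]%SET = finset.set0) ?cards0 //; apply/setP => z; rewrite !inE.
  - by rewrite finset.setD0; case: H => [|->]; [left|right].
elim: n B C e => [|n IH] B C e BC bde He; first by apply: trivial; right.
case: (leqP #|B| a) => Ba; first by apply: trivial; left.
have [h Hh] := exists_overlap B C.
set D0 := (B :&: ltrans h @^-1: C)%SET in Hh.
have preB : boundary skew_perm (ltrans h @^-1: C)%SET = boundary skew_perm C.
  by apply: boundary_preim => j x; exact: skew_ltrans.
have gD0 : g <= #|D0|.
  have Z0 : 0 < #|{: Y * V}|.
    by apply: leq_trans (max_card (mem B)); apply: leq_ltn_trans Ba.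
  rewrite -(leq_add2r (4 * K * (2 ^ n.+1 * e))) -(leq_pmul2l Z0).
  apply: leq_trans He _; apply: (@leq_trans (#|B| * #|C|)).
    by rewrite -BC leq_mul // ltnW.
  apply: leq_trans Hh _; rewrite leq_mul2l leq_add2l leq_mul2l; apply/orP; right.
  apply/orP; right; apply: leq_trans (leq_trans (leq_addr _ _) bde) _.
  by rewrite leq_pmull ?expn_gt0.
pose B1 := (B :\: D0)%SET; pose C1 := (C :\: ltrans h @: D0)%SET.
have D0B : D0 \subset B by exact: finset.subsetIl.
have imC : (ltrans h @: D0)%SET \subset C.
  by apply/fintype.subsetP => _ /imsetP[z + ->]; rewrite !inE => /andP[].
have BC1 : #|B1| = #|C1|.
  rewrite !cardsD; have /finset.setIidPr -> := D0B; have /finset.setIidPr -> := imC.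
  by rewrite BC card_imset //; exact: perm_inj.
have bdB1 : boundary skew_perm B1 <= e.
  have -> : B1 = (B :\: ltrans h @^-1: C)%SET.
    by apply/setP => z; rewrite !inE; case: (z \in B); rewrite ?andbF.
  by rewrite (leq_trans (boundaryD _ _ _)) // preB.
have bdC1 : boundary skew_perm C1 <= e.
  rewrite -(@boundary_preim _ _ skew_perm (ltrans h)); last by move=> j x; exact: skew_ltrans.
  have -> : (ltrans h @^-1: C1 = ltrans h @^-1: C :\: B)%SET.
    apply/setP => z; rewrite !inE mem_imset; last exact: perm_inj.
    by rewrite !inE; case: (z \in B); case: (ltrans h z \in C).
  by rewrite (leq_trans (boundaryD _ _ _)) // preB addnC.
have bdD0 : boundary skew_perm D0 <= e by rewrite (leq_trans (boundaryI _ _ _)) // preB.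
clearbody D0.
(* Both remainders have boundary at most [e], so the budget doubles at each round. *)
have [||phi [D [DB phiI phiC dD alt]]] := IH B1 C1 (2 * e) BC1.
- by rewrite mul2n -addnn leq_add.
- by rewrite [2 ^ n * _]mulnA -expnSr.
pose psi z := if z \in D0 then ltrans h z else phi z.
have DD0 z : z \in D -> z \notin D0.
  by move=> /(fintype.subsetP DB); rewrite inE => /andP[].
exists psi, (D0 :|: D)%SET; split.
- rewrite finset.subUset D0B; apply: fintype.subset_trans DB _; exact: finset.subsetDl.
- have sep x y : x \in D0 -> y \in D -> ltrans h x != phi y.
    move=> xD yD; have := phiC y yD; rewrite finset.in_setD => /andP[+ _].
    by apply: contraNneq => <-; rewrite imset_f.
  move=> x y; rewrite !finset.in_setU /psi; case: (boolP (x \in D0)) => xD /=;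
    case: (boolP (y \in D0)) => yD /=.
  + by move=> _ _ /perm_inj.
  + by move=> _ yD' /eqP; rewrite (negPf (sep _ _ xD yD')).
  + by move=> xD' _ /esym/eqP; rewrite (negPf (sep _ _ yD xD')).
  + exact: phiI.
- move=> z; rewrite finset.in_setU /psi; case: ifP => [zD0 _|_ /= /phiC]; last by rewrite inE => /andP[].
  by apply: (fintype.subsetP imC); exact: imset_f.
(* The moved part [D0] adds at most its boundary, since translations commute with the action; the
   extra [e] in the inductive bound pays for it. *)
- have : defect skew_perm psi (D0 :|: D)%SET <= boundary skew_perm D0 + defect skew_perm phi D.
    rewrite -big_split /=; apply: leq_sum => j _.
    apply: leq_trans (leq_card_setU _ _); apply/subset_leq_card/fintype.subsetP => z.
    move: (DD0 z) (DD0 (skew_perm j z)); rewrite !inE => dz dtz /andP[zU bad].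
    apply/orP.
    case/orP: zU => zD; [left; rewrite zD /=|right; rewrite zD /=].
      apply: contraNN bad => tD; rewrite tD /psi zD tD skew_ltrans eqxx.
      by [].
    apply: contraNN bad => /andP[tD E]; rewrite tD orbT /psi.
    by rewrite (negPf (dz zD)) (negPf (dtz tD)).
  by rewrite expnSr -mulnA; move: dD bdD0; lia.
- have BD : (B :\: (D0 :|: D) = B1 :\: D)%SET by rewrite /B1 finset.setDDl.
  rewrite BD; case: alt => [|H]; [by left|right].
  have -> : #|(D0 :|: D)%SET| = #|D0| + #|D|.
    rewrite cardsU (_ : D0 :&: D = finset.set0)%SET ?cards0 ?subn0 //.
    by apply/setP => z; rewrite finset.in_setI finset.in_set0; apply/negP => /andP[zD0 /DD0]; rewrite zD0.
  by rewrite mulSn leq_add.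
Qed.

(** Write [N] for the size of [Y * V] and [N = 2 p^2 g]. The tolerated remainder is
    [a = 2 p g = N / p]; then [a^2 = 2 N g] leaves [N g] for the errors. If [N] is nonzero,
    [2 p^2 + 1] gains of [g] would exceed [N], so the remainder must become small. *)
Lemma matching p (B C : {set Y * V}) e : 0 < p -> #|B| = #|C| ->
  boundary skew_perm B + boundary skew_perm C <= e ->
  2 * p ^ 2 %| #|{: Y * V}| ->
  8 * p ^ 2 * K * 2 ^ (2 * p ^ 2 + 1) * e <= #|{: Y * V}| ->
  exists (phi : Y * V -> Y * V) (D : {set Y * V}),
    [/\ D \subset B, {in D &, injective phi}, {in D, forall z, phi z \in C},
        defect skew_perm phi D <= 2 ^ (2 * p ^ 2 + 1) * e
      & p * #|B :\: D| <= #|{: Y * V}|].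
Proof.
move=> p0 BC bde /dvdnP[g Zg] He.
have [|phi [D [DB phiI phiC dD alt]]] :=
  @greedy_matching (g * (2 * p)) g (2 * p ^ 2 + 1) B C e BC bde.
  rewrite Zg -mulnA; have : 4 * K * (2 ^ (2 * p ^ 2 + 1) * e) <= g.
    rewrite -(@leq_pmul2l (2 * p ^ 2)) ?muln_gt0 ?expn_gt0 ?p0 // [leqRHS]mulnC -Zg.
    by apply: leq_trans He; rewrite leq_eqVlt; apply/orP; left; apply/eqP; ring.
  move: (4 * K * _) => x xg; nia.
exists phi, D; split=> //; first by apply: leq_trans dD; exact: leq_addr.
case: alt => [H|H].
  apply: leq_trans (leq_mul (leqnn p) H) _; rewrite Zg; nia.
have : #|D| <= #|{: Y * V}| by exact: max_card.
have := max_card (mem (B :\: D)%SET); rewrite Zg.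
case: g {Zg He} H => [|g] H; first by rewrite mul0n leqn0 => /eqP ->; rewrite muln0.
by move=> _ /(leq_trans H); rewrite mulnDl; nia.
Qed.

End Matching.

(** * Almost equivariant maps *)

Section EquivarianceError.
Local Open Scope nat_scope.

Definition eqv_error (J X X' : finType) (t : J -> {perm X}) (t' : J -> {perm X'})
    (f : X -> X') : nat :=
  \sum_j #|[set x | f (t j x) != t' j (f x)]%SET|.

(** The complements of [D] and of its image are equinumerous and are matched through their
    enumerations. *)
Lemma extend_inj (X X' : finType) (f : X -> X') (D : {set X}) :
  #|X| = #|X'| -> {in D &, injective f} ->
  exists g : X -> X', injective g /\ {in D, g =1 f}.
Proof.
move=> XX' fD; pose E := (~: D)%SET; pose F := (~: (f @: D))%SET.
have EF : #|E| = #|F|.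
  by rewrite [LHS]finset.cardsCs [RHS]finset.cardsCs !finset.setCK XX' card_in_imset.
pose g x := if x \in D then f x else nth (f x) (enum F) (index x (enum E)).
have sz : size (enum E) = size (enum F) by rewrite -!cardE.
have iE z : z \notin D -> (index z (enum E) < size (enum F)).
  by move=> zD; rewrite -sz index_mem mem_enum inE.
have gF x : x \notin D -> g x \in F.
  by move=> xD; rewrite /g (negPf xD) -mem_enum mem_nth // iE.
have gD x : x \in D -> g x \notin F.
  by move=> xD; rewrite /g xD !inE negbK imset_f.
exists g; split; last by move=> x xD; rewrite /g xD.
move=> x y; case: (boolP (x \in D)) => xD; case: (boolP (y \in D)) => yD e.
- by apply: fD => //; move: e; rewrite /g xD yD.
- by have := gF y yD; rewrite -e (negPf (gD x xD)).
- by have := gF x xD; rewrite e (negPf (gD y yD)).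
move: e; rewrite /g (negPf xD) (negPf yD) (set_nth_default (f x) _ (iE y yD)).
move/eqP; rewrite nth_uniq ?iE ?enum_uniq // => /eqP.
have mE z : z \notin D -> z \in enum E by rewrite mem_enum inE.
by move=> e; rewrite -(nth_index x (mE x xD)) e nth_index ?mE.
Qed.

Lemma exists_inj (X X' : finType) : #|X| = #|X'| -> exists g : X -> X', injective g.
Proof.
move=> e; exists (fun x => enum_val (cast_ord e (enum_rank x))) => x y.
by move=> /enum_val_inj/cast_ord_inj/enum_rank_inj.
Qed.

Lemma eqv_error_comp (J X1 X2 X3 : finType) (t1 : J -> {perm X1}) (t2 : J -> {perm X2})
    (t3 : J -> {perm X3}) (f : X1 -> X2) (g : X2 -> X3) :
  injective f -> (forall j x, f (t1 j x) = t2 j (f x)) ->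
  eqv_error t1 t3 (g \o f) <= eqv_error t2 t3 g.
Proof.
move=> fi ft; apply: leq_sum => j _; rewrite -(card_imset _ fi).
apply/subset_leq_card/fintype.subsetP => _ /imsetP[x + ->].
by rewrite !inE /= ft.
Qed.

Lemma eqv_error_compl (J X1 X2 X3 : finType) (t1 : J -> {perm X1}) (t2 : J -> {perm X2})
    (t3 : J -> {perm X3}) (f : X1 -> X2) (g : X2 -> X3) :
  (forall j x, g (t2 j x) = t3 j (g x)) ->
  eqv_error t1 t3 (g \o f) <= eqv_error t1 t2 f.
Proof.
move=> gt; apply: leq_sum => j _; apply/subset_leq_card/fintype.subsetP => x.
by rewrite !inE /= -gt; apply: contraNN => /eqP ->.
Qed.

Lemma pamp_inj (X W : finType) (u : {perm X}) :
  injective (fun z : X * W => (u z.1, z.2)).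
Proof.
move=> [x v] [x' v'] e; have /= /perm_inj -> := congr1 fst e.
by have /= -> := congr1 snd e.
Qed.

Definition pamp (X W : finType) (u : {perm X}) : {perm X * W} := perm (@pamp_inj X W u).

Lemma pampE (X W : finType) (u : {perm X}) z : pamp W u z = (u z.1, z.2).
Proof. by rewrite permE. Qed.

(** The error of [f] is the sum of the errors of its columns, so the best column has at most the
    average. *)
Lemma exists_column (J X X' W : finType) (t : J -> {perm X}) (t' : J -> {perm X'})
    (f : X * W -> X') : 0 < #|W| ->
  exists w, #|W| * eqv_error t t' (fun x => f (x, w)) <=
    eqv_error (fun j => pamp W (t j)) t' f.
Proof.
case/card_gt0P => w0 _.
pose E w := eqv_error t t' (fun x => f (x, w)).
have [w wmin] : exists w, forall w', E w <= E w'.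
  by case: (@arg_minnP W w0 predT E) => // w _ H; exists w => w'; exact: H.
exists w; rewrite -sum_nat_const; apply: (@leq_trans (\sum_w' E w')).
  by apply: leq_sum => w' _; exact: wmin.
rewrite exchange_big /=; apply: leq_sum => j _.
set B := leqRHS.
have -> : B = \sum_v \sum_x if f (t j x, v) != t' j (f (x, v)) then 1 else 0.
  rewrite exchange_big pair_big /= /B -sum1_card big_mkcond /=.
  by apply: eq_bigr => -[x v] _; rewrite inE pampE.
apply: leq_sum => v _; rewrite -sum1_card big_mkcond /=.
by apply: leq_sum => x _; rewrite inE.
Qed.

(* Push the uniform measure of [X] forward to [T * 'I_16]: it is almost        *)
(* invariant with small support, which the expander does not allow.            *)
Lemma expander_no_small_image (X T : finType) (u : 'I_2 -> {perm X})
    (t : 'I_16 -> {perm T}) (f : X -> T * 'I_16) :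
  expander t -> 2 * #|X| <= #|T| -> #|X| <= 2 ^ 14 * (2 * eqv_error u (two_gen t) f).
Proof.
move=> expt XT; pose h y := #|[set x | f x == y]%SET|.
have supp : 2 * #|[set y | 0 < h y]%SET| <= #|T|.
  apply: leq_trans XT; rewrite leq_mul2l /=.
  apply: (@leq_trans #|(f @: [set: X])%SET|); last by rewrite (leq_trans (leq_imset_card _ _)) // finset.cardsT.
  apply/subset_leq_card/fintype.subsetP => y; rewrite inE => /card_gt0P[x].
  by rewrite inE => /eqP <-; rewrite imset_f.
have sh (g : X -> T * 'I_16) : \sum_y #|[set x | g x == y]%SET| = #|X|.
  rewrite -sum1_card (partition_big g predT) //=; apply: eq_bigr => y _.
  by rewrite -sum1_card; apply: eq_bigl => x; rewrite inE.
rewrite -(sh f); apply: leq_trans (two_gen_sum_le expt supp) (leq_mul (leqnn _) _).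
rewrite /edge_variation /eqv_error big_distrr /=; apply: leq_sum => j _.
set s := two_gen t j.
pose bad := [set x | f (u j x) != s (f x)]%SET.
have e1 y : h (s y) = #|[set x | f (u j x) == s y]%SET|.
  rewrite /h -[LHS](card_preimset _ (@perm_inj _ (u j))); apply: eq_card => x.
  by rewrite !inE.
have e2 y : h y = #|[set x | s (f x) == s y]%SET|.
  by apply: eq_card => x; rewrite !inE (inj_eq (@perm_inj _ s)).
apply: (@leq_trans (\sum_y (#|bad :&: [set x | f x == y]%SET|%SET +
    #|bad :&: [set x | f (u j x) == s y]%SET|%SET))).
  apply: leq_sum => y _; rewrite e1 e2 /ndist.
  set A := [set x | s (f x) == s y]%SET; set B := [set x | f (u j x) == s y]%SET.
  have hA := cardsID B A; have hB := cardsID A B; rewrite finset.setIC in hB.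
  have sA : #|(A :\: B)%SET| <= #|(bad :&: [set x | f x == y])%SET|.
    apply/subset_leq_card/fintype.subsetP => x; rewrite !inE (inj_eq (@perm_inj _ s)).
    by move=> /andP[+ /eqP ->]; rewrite eqxx andbT.
  have sB : #|(B :\: A)%SET| <= #|(bad :&: B)%SET|.
    apply/subset_leq_card/fintype.subsetP => x; rewrite !inE.
    by move=> /andP[+ /eqP ->]; rewrite eqxx andbT eq_sym.
  lia.
have cI (g : X -> T * 'I_16) : \sum_y #|(bad :&: [set x | g x == y])%SET| = #|bad|.
  rewrite -[RHS]sum1_card (partition_big g predT) //=; apply: eq_bigr => y _.
  by rewrite -sum1_card; apply: eq_bigl => x; rewrite !inE.
rewrite big_split /= cI (reindex_inj (@perm_inj _ s^-1%g)) /=.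
under eq_bigr do rewrite permKV.
by rewrite cI mul2n addnn.
Qed.

End EquivarianceError.

(** * Absorbing a piece of positive density into the model *)

Section Absorb.
Local Open Scope nat_scope.
Variables (Y : finType) (Q : finGroupType) (s : 'I_2 -> {perm Y}) (c : 'I_2 -> Q) (K : nat).
Hypothesis poincare : forall f : Y -> nat, exists m, \sum_y ndist (f y) m <= K * edge_variation s f.
Variables (M : finType) (t : 'I_2 -> {perm M}).

(* For [p = 0] the bound on the errors is void.                                *)
Definition near_iso (X : finType) (th : 'I_2 -> {perm X}) (p : nat) : Prop :=
  exists (r q : nat) (g : M * 'I_r -> X * 'I_q),
    [/\ 0 < r, 0 < q, #|M| * r = #|X| * q, injective g &
        p * eqv_error (fun j => pamp 'I_r (t j)) (fun j => pamp 'I_q (th j)) g <= #|M| * r].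

Lemma near_iso0 (X : finType) (th : 'I_2 -> {perm X}) : 0 < #|M| -> 0 < #|X| -> near_iso th 0.
Proof.
move=> M0 X0; have [|g gi] := @exists_inj (M * 'I_#|X|)%type (X * 'I_#|M|)%type.
  by rewrite !card_prod !card_ord mulnC.
by exists #|X|, #|M|, g; split => //; rewrite mulnC.
Qed.

(** [p1] is the precision asked of [matching] and [e] the growth of its defect. The first summand
    meets the hypothesis of [matching]; the second brings the final error below precision [p]. *)
Definition absorb_factor (p d : nat) : nat :=
  let p1 := 4 * p * d in let e := 2 ^ (2 * p1 ^ 2 + 1) in
  8 * p1 ^ 2 * K * e + 2 * p * (1 + e).

(** The amplifying factor becomes a group on which the generators act trivially, so that [matching]
    may also translate along it. *)
Definition cgroup (W : finGroupType) (j : 'I_2) : Q * W := (c j, 1%g).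

(** The image [B] of [psi] has boundary at most [e] and the size of the invariant set [C1], a
    [t0]-fold amplification of [Y * Q]. Most of [B] is matched into [C1], and [extend_inj] completes
    this to a bijection. The bound [d] on the inverse density makes the unmatched part small
    relative to [|M| |C|]. *)
Lemma absorb_group (p d : nat) (C : finType) (W : finGroupType) (t0 : nat)
    (psi : M * C -> Y * (Q * W)) :
  let e := eqv_error (fun j => pamp C (t j)) (skew_perm s (@cgroup W)) psi in
  0 < p -> 0 < d -> 0 < #|M| -> 0 < #|C| -> injective psi ->
  #|M| * #|C| = #|Y| * #|Q| * t0 ->
  2 * (4 * p * d) ^ 2 %| #|{: Y * (Q * W)}| ->
  #|{: Y * (Q * W)}| <= d * (#|M| * #|C|) ->
  absorb_factor p d * e <= #|M| * #|C| ->
  near_iso (skew_perm s c) p.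
Proof.
move=> e p0 d0 M0 C0 psi_inj MC div dens He.
set th := skew_perm s (@cgroup W) in e He.
have N0 : 0 < #|M| * #|C| by rewrite muln_gt0 M0.
have t00 : 0 < t0 by move: N0; rewrite MC muln_gt0 => /andP[].
have YQ0 : 0 < #|Y| * #|Q| by move: N0; rewrite MC muln_gt0 => /andP[].
pose B := (psi @: [set: M * C])%SET.
have cB : #|B| = #|M| * #|C| by rewrite card_imset // finset.cardsT card_prod.
have NZ : #|M| * #|C| <= #|{: Y * (Q * W)}| by rewrite -cB max_card.
have t0W : t0 <= #|W|.
  by move: NZ; rewrite MC !card_prod mulnA leq_pmul2l.
pose ka (x : (Y * Q) * 'I_t0) : Y * (Q * W) := (x.1.1, (x.1.2, enum_val (widen_ord t0W x.2))).
have ka_inj : injective ka.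
  move=> [[y q] i] [[y' q'] i'] ee; have /= -> := congr1 fst ee.
  have /= -> := congr1 (fst \o snd) ee.
  by have /= /enum_val_inj/(congr1 val)/= /val_inj -> := congr1 (snd \o snd) ee.
have ka_th j x : ka (pamp 'I_t0 (skew_perm s c j) x) = th j (ka x).
  by rewrite /ka pampE /= !skew_permE /= /cgroup /=; congr (_, (_, _)); rewrite mulg1.
pose C1 := (ka @: [set: (Y * Q) * 'I_t0])%SET.
have BC : #|B| = #|C1| by rewrite cB MC card_imset // finset.cardsT !card_prod card_ord.
have bdC1 : boundary th C1 = 0.
  rewrite /boundary big1 // => j _; apply/eqP; rewrite cards_eq0; apply/eqP/setP => z.
  rewrite !inE; apply/negP => /andP[/imsetP[x _ ->]]; rewrite -ka_th.
  by rewrite imset_f.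
have bdB : boundary th B <= e.
  apply: leq_sum => j _; rewrite -(card_imset _ psi_inj).
  apply/subset_leq_card/fintype.subsetP => z; rewrite inE => /andP[/imsetP[x _ ->]] H.
  rewrite imset_f // inE; apply: contraNN H => /eqP <-; by rewrite imset_f.
pose p1 := 4 * p * d.
have p10 : 0 < p1 by rewrite !muln_gt0 p0.
set E := 2 ^ (2 * p1 ^ 2 + 1).
have He' : (8 * p1 ^ 2 * K * E + 2 * p * (1 + E)) * e <= #|M| * #|C| := He.
have [||phi [D [DB phiI phiC dD bD]]] := @matching Y (Q * W)%type s (@cgroup W) K poincare p1 B C1 e p10 BC _ div.
- by rewrite bdC1 addn0.
- by apply: leq_trans NZ; apply: leq_trans He'; rewrite -/E leq_mul2r leq_addr orbT.
rewrite -/th -/E in dD.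
have /card_gt0P[y0 _] : 0 < #|{: (Y * Q) * 'I_t0}|.
  by rewrite !card_prod card_ord muln_gt0 YQ0.
pose ik z := odflt y0 [pick x | ka x == z].
have ikK z : z \in C1 -> ka (ik z) = z.
  move=> /imsetP[x _ ->]; rewrite /ik; case: pickP => [x' /eqP //|/(_ x)].
  by rewrite eqxx.
pose D' := (psi @^-1: D)%SET.
have [g [g_inj gD]] : exists g : M * C -> (Y * Q) * 'I_t0,
    injective g /\ {in D', g =1 (fun x => ik (phi (psi x)))}.
  apply: extend_inj; first by rewrite !card_prod card_ord.
  move=> x y; rewrite !inE => xD yD /(congr1 ka); rewrite !ikK ?phiC //.
  by move=> /(phiI _ _ xD yD)/psi_inj.
have gE x : psi x \in D -> ka (g x) = phi (psi x).
  by move=> xD; rewrite gD ?inE // ikK ?phiC.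
have err : eqv_error (fun j => pamp C (t j)) (fun j => pamp 'I_t0 (skew_perm s c j)) g <=
    e + 2 * #|(B :\: D)%SET| + defect th phi D.
  have -> : 2 * #|(B :\: D)%SET| = \sum_(j < 2) #|(B :\: D)%SET|.
    by rewrite sum_nat_const card_ord.
  rewrite -!big_split /=; apply: leq_sum => j _.
  set X1 := [set _ | _]%SET; set X2 := [set _ | _]%SET; set X3 := [set _ in D | _]%SET.
  have e1 : #|(psi @^-1: (B :\: D))%SET| <= #|(B :\: D)%SET|.
    rewrite -(card_imset _ psi_inj); apply/subset_leq_card/fintype.subsetP.
    by move=> _ /imsetP[x + ->]; rewrite inE.
  have e2 : #|(psi @^-1: X3)%SET| <= #|X3|.
    rewrite -(card_imset _ psi_inj); apply/subset_leq_card/fintype.subsetP.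
    by move=> _ /imsetP[x + ->]; rewrite inE.
  apply: leq_trans (leq_add (leq_add (leqnn _) e1) e2).
  apply: leq_trans (leq_add (leq_card_setU _ _) (leqnn _)).
  apply: leq_trans (leq_card_setU _ _); apply/subset_leq_card/fintype.subsetP => x.
  rewrite !finset.in_setU; apply: contraTT; rewrite !negb_or => /andP[/andP[h1 h2] h3].
  rewrite inE negbK in h1; rewrite !inE imset_f // andbT negbK in h2.
  rewrite !inE h2 /= negbK in h3; case/andP: h3 => h3 /eqP h4.
  rewrite inE negbK; apply/eqP/ka_inj; rewrite ka_th gE ?(eqP h1) //.
  by rewrite h4 gE.
exists #|C|, t0, (fun x => g (x.1, enum_val x.2)); split => //.
- by rewrite MC card_prod.
- move=> [m i] [m' i'] /g_inj ee; have /= -> := congr1 fst ee.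
  by have /= /enum_val_inj -> := congr1 snd ee.
pose ev (x : M * 'I_#|C|) : M * C := (x.1, enum_val x.2).
have ev_inj : injective ev.
  move=> [m i] [m' i'] ee; have /= -> := congr1 fst ee.
  by have /= /enum_val_inj -> := congr1 snd ee.
have ev_t j x : ev (pamp 'I_#|C| (t j) x) = pamp C (t j) (ev x) by rewrite !pampE.
have err' := leq_trans (eqv_error_comp (fun j => pamp 'I_t0 (skew_perm s c j)) g ev_inj ev_t) err.
apply: leq_trans (leq_mul (leqnn p) err') _.
have h1 : 4 * p * #|(B :\: D)%SET| <= #|M| * #|C|.
  rewrite -(leq_pmul2l d0); apply: leq_trans dens; apply: leq_trans bD.
  by rewrite /p1 leq_eqVlt; apply/orP; left; apply/eqP; ring.
have h2 : 2 * p * (e + E * e) <= #|M| * #|C|.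
  apply: leq_trans He'; rewrite [leqRHS]mulnDl.
  apply: leq_trans (leq_addl _ _); rewrite leq_eqVlt; apply/orP; left; apply/eqP; ring.
have h3 : 2 * (p * (e + 2 * #|(B :\: D)%SET| + E * e)) <= 2 * (#|M| * #|C|).
  rewrite [leqRHS]mul2n -addnn; apply: leq_trans (leq_add h2 h1).
  by rewrite leq_eqVlt; apply/orP; left; apply/eqP; ring.
rewrite -(@leq_pmul2l 2) //; apply: leq_trans h3.
by do 2!apply: leq_mul => //; rewrite leq_add2l.
Qed.

(** Reduction to [absorb_group] by amplifying further by [L]: its factor [|Y| |Q|] makes an exact
    [t0] available, and its factor [k] gives the divisibility needed for [matching]. *)
Lemma absorb (p d a : nat) (C : finType) (psi : M * C -> (Y * Q) * 'I_a) :
  let e := eqv_error (fun j => pamp C (t j)) (fun j => pamp 'I_a (skew_perm s c j)) psi in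
  0 < p -> 0 < d -> 0 < #|M| -> 0 < #|C| -> injective psi ->
  #|Y| * #|Q| * a <= d * (#|M| * #|C|) ->
  absorb_factor p d * e <= #|M| * #|C| ->
  near_iso (skew_perm s c) p.
Proof.
move=> e p0 d0 M0 C0 psi_inj dens He.
have N0 : 0 < #|M| * #|C| by rewrite muln_gt0 M0.
have : #|M| * #|C| <= #|Y| * #|Q| * a.
  rewrite -(card_ord a) -!card_prod; exact: leq_card psi_inj.
move=> /(leq_trans N0); rewrite muln_gt0 => /andP[YQ0 a0].
pose k := 2 * (4 * p * d) ^ 2; pose L := #|Y| * #|Q| * k.
have k0 : 0 < k by rewrite /k muln_gt0 expn_gt0 !muln_gt0 p0 d0.
have L0 : 0 < L by rewrite muln_gt0 YQ0.
have aL0 : 0 < a * L by rewrite muln_gt0 a0.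
(* Any group of order [a * L] would do; this one is cyclic. *)
pose W : finGroupType := 'I_(a * L).-1.+1.
have cW : #|W| = a * L by rewrite card_ord prednK.
have [be be_inj] := @exists_inj ('I_a * 'I_L)%type W (etrans (etrans (card_prod _ _)
  (congr2 muln (card_ord a) (card_ord L))) (esym cW)).
pose psiL (x : M * (C * 'I_L)) : Y * (Q * W) :=
  let z := psi (x.1, x.2.1) in (z.1.1, (z.1.2, be (z.2, x.2.2))).
apply: (@absorb_group p d (C * 'I_L)%type W (#|M| * #|C| * k) psiL) => //.
- by rewrite card_prod card_ord muln_gt0 C0.
- move=> [m [x l]] [m' [x' l']] ee.
  have /be_inj [e3 e4] := congr1 (snd \o snd) ee.
  have /= e1 := congr1 fst ee; have /= e2 := congr1 (fst \o snd) ee.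
  have : psi (m, x) = psi (m', x').
    by move: e1 e2 e3 => /=; case: (psi (m, x)) => [[? ?] ?]; case: (psi (m', x')) => [[? ?] ?] /= -> -> ->.
  by move=> /psi_inj [-> ->]; rewrite e4.
- by rewrite card_prod card_ord /L; ring.
- by rewrite !card_prod cW /L; apply/dvdnP; exists (#|Y| * #|Q| * a * (#|Y| * #|Q|)); rewrite -/k; ring.
- rewrite !card_prod cW card_ord.
  have := leq_mul dens (leqnn L).
  by congr (_ <= _); ring.
have -> : #|M| * #|{: C * 'I_L}| = #|M| * #|C| * L by rewrite card_prod card_ord mulnA.
apply: leq_trans (leq_mul He (leqnn L)); rewrite -mulnA leq_mul2l; apply/orP; right.
rewrite big_distrl /=; apply: leq_sum => j _.
set X := [set _ | _]%SET.
rewrite -[L in leqRHS]card_ord -cardsT -finset.cardsX.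
pose h (x : M * (C * 'I_L)) := ((x.1, x.2.1), x.2.2).
rewrite -(card_imset _ (_ : injective h)); last by move=> [? [? ?]] [? [? ?]] [-> -> ->].
apply/subset_leq_card/fintype.subsetP => _ /imsetP[[m [x l]] + ->]; rewrite !inE andbT /=.
apply: contraNN; rewrite /psiL /= !pampE /= => /eqP ->.
by rewrite !skew_permE /= /cgroup; apply/eqP; congr (_, (_, _)) => /=; rewrite mulg1.
Qed.

End Absorb.

(** * Finite models of the free group *)

Section FiniteQuotients.
Local Open Scope group_scope.

Lemma perm_of_inj (T : finType) (f : T -> T) (D : {set T}) :
  {in D &, injective f} -> exists u : {perm T}, {in D, u =1 f}.
Proof.
move=> fD; have [g [gi gD]] := extend_inj (erefl #|T|) fD.
by exists (perm gi) => x xD; rewrite permE gD.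
Qed.

Local Notation word k := {bseq k of 'I_2 * bool}.

Lemma reduced_catrev (s t : seq ('I_2 * bool)) : reduced (catrev s t) -> reduced t.
Proof. by rewrite catrevE /reduced => /cat_sorted2[]. Qed.

Lemma reduced_behead a (s : seq ('I_2 * bool)) : reduced (a :: s) -> reduced s.
Proof. by case: s => //= b s /andP[]. Qed.

Lemma cons_red_reduced a (s : seq ('I_2 * bool)) : reduced (a :: s) -> cons_red a s = a :: s.
Proof. by case: s => //= b s /andP[/negPf ->]. Qed.

(* Words act on words by (cancelling) concatenation; truncating this partial   *)
(* action at length [k] and completing it to permutations separates the short *)
(* words.                                                                      *)
Lemma exists_separating k : exists c : 'I_2 -> {perm word k},
  forall g : F2, g != 1 -> (size g < k)%N -> fg_eval c g != 1.
Proof.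
pose D := [set v : word k | reduced v && (size v < k)%N]%SET.
(* [insub_bseq] returns a default on overlong words, which does not occur on [D]. *)
pose f x (v : word k) : word k := insub_bseq k (cons_red (x, true) v).
have sz a (v : seq ('I_2 * bool)) : (size (cons_red a v) <= (size v).+1)%N.
  by case: v => //= b v; case: ifP => //= _; rewrite ltnW // ltnW.
have fE x v : v \in D -> f x v = cons_red (x, true) v :> seq _.
  rewrite inE => /andP[_ vk]; rewrite /f val_insubd.
  by rewrite (leq_trans (sz _ _) vk).
have fD x : {in D &, injective (f x)}.
  move=> v v' vD v'D e; apply: val_inj => /=.
  have := congr1 (fun z : word k => z : seq _) e; rewrite !fE // => e'.
  move: vD v'D; rewrite !inE => /andP[rv _] /andP[rv' _].
  have := congr1 (cons_red (letter_inv (x, true))) e'.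
  by rewrite (cons_redK _ rv) (cons_redK _ rv').
have [c Hc] := choice (fun x => perm_of_inj (fD x)).
have step a (v v' : word k) : v' = a :: v :> seq _ -> reduced v' -> (size v' < k)%N ->
    letter_eval c a v = v'.
  case: a => x b v'E rv' sv'.
  have rv : reduced v by apply: (@reduced_behead (x, b)); rewrite -v'E.
  have sv : (size v < k)%N by apply: leq_trans sv'; rewrite v'E /=; exact: ltnW.
  rewrite v'E in rv'; case: b v'E rv' => v'E rv'; rewrite /letter_eval /=.
    by apply: val_inj; rewrite /= Hc ?fE ?inE ?rv // v'E cons_red_reduced.
  apply: (@perm_inj _ (c x)); rewrite permKV; apply/esym/val_inj.
  by rewrite /= Hc ?fE ?inE v'E ?rv' -?v'E // v'E /= eqxx.
have main (s : seq ('I_2 * bool)) : forall v v' : word k, v' = catrev s v :> seq _ -> reduced v' ->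
    (size v' < k)%N -> foldr (fun a h => letter_eval c a * h) 1 s v = v'.
  elim: s => [|a s IH] v v' /= v'E rv' sv'; first by rewrite perm1; exact/esym/val_inj.
  have rav : reduced (a :: v) by apply: (@reduced_catrev s); rewrite -v'E.
  have sav : (size (a :: v) < k)%N.
    by apply: leq_ltn_trans sv'; rewrite v'E catrevE size_cat leq_addl.
  pose av : word k := insub_bseq k (a :: v).
  have avE : av = a :: v :> seq _ by rewrite /= val_insubd (ltnW sav).
  rewrite permM (step a v av avE) ?avE //; apply: IH => //.
  by rewrite avE.
exists c => g g1 gk; apply/eqP => /(congr1 (fun u : {perm word k} => u (insub_bseq k [::]) : seq _)).
have v0 : (insub_bseq k [::] : word k) = [::] :> seq _ by rewrite /= val_insubd.
have rE : (insub_bseq k (rev g) : word k) = rev g :> seq _.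
  by rewrite /= val_insubd size_rev (ltnW gk).
(* Permutations compose from left to right, so the first letter acts first and the empty word is
   sent to the reversal of [g]. *)
rewrite /fg_eval (main _ _ (insub_bseq k (rev g))) ?perm1 ?rE ?v0 ?size_rev //.
  move/(congr1 rev); rewrite revK /= => gE; move: g1; apply/negP; rewrite negbK.
  by apply/eqP/val_inj.
move: (fg_reduced g); rewrite /reduced rev_sorted; apply: sub_sorted => a b /=.
by apply: contraNneq => ->; rewrite letter_invK.
Qed.

Lemma fg_eval_morph (X : choiceType) (G H : groupType) (h : G -> H) (f : X -> G) :
  {morph h : x y / x * y} -> forall g, h (fg_eval f g) = fg_eval (h \o f) g.
Proof.
move=> hM g; have h1 : h 1 = 1 by apply: (@mulgI _ (h 1)); rewrite -hM !mulg1.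
have hV x : h x^-1 = (h x)^-1 by apply: (@mulgI _ (h x)); rewrite -hM !mulgV.
rewrite /fg_eval; elim: (fg_word g) => //= a s IH; rewrite hM IH; congr (_ * _).
by rewrite /letter_eval; case: ifP.
Qed.

Lemma fg_hom_ext (X : choiceType) (G : groupType) (h1 h2 : free_group X -> G) :
  {morph h1 : x y / x * y} -> {morph h2 : x y / x * y} ->
  (forall x, h1 (fg_gen x) = h2 (fg_gen x)) -> h1 =1 h2.
Proof.
move=> m1 m2 e g.
pose H1 : {multiplicative free_group X -> G} := HB.pack h1 (isMultiplicative.Build _ _ h1 m1).
pose H2 : {multiplicative free_group X -> G} := HB.pack h2 (isMultiplicative.Build _ _ h2 m2).
by rewrite -[LHS]/(H1 g) -[RHS]/(H2 g) (@fg_eval_unique _ _ (fun x => h2 (fg_gen x)) H1) ?(@fg_eval_unique _ _ (fun x => h2 (fg_gen x)) H2).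
Qed.

Lemma skew_perm_eval (Y : finType) (V : finGroupType) (s : 'I_2 -> {perm Y}) (c : 'I_2 -> V)
    (g : F2) z :
  (fg_eval (skew_perm s c) g z).2 = z.2 * fg_eval c g.
Proof.
rewrite /fg_eval; elim: (fg_word g) z => [|a l IH] z /=; first by rewrite perm1 mulg1.
rewrite permM IH mulgA; congr (_ * _); rewrite /letter_eval; case: ifP => _.
  by rewrite skew_permE.
by rewrite -{2}[z](permKV (skew_perm s c a.1)) [in RHS]skew_permE /= mulgK.
Qed.

Lemma ord_perm_inj (X : finType) (u : {perm X}) :
  injective (fun i : 'I_#|X| => enum_rank (u (enum_val i))).
Proof. by move=> i j /enum_rank_inj/perm_inj/enum_val_inj. Qed.

Definition ord_perm (X : finType) (u : {perm X}) : 'S_#|X| := perm (@ord_perm_inj X u).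

Lemma ord_permE (X : finType) (u : {perm X}) i : enum_val (ord_perm u i) = u (enum_val i).
Proof. by rewrite permE enum_rankK. Qed.

Lemma ord_permM (X : finType) : {morph @ord_perm X : u v / u * v}.
Proof.
by move=> u v; apply/permP => i; apply: enum_val_inj; rewrite ord_permE !permM !ord_permE.
Qed.

End FiniteQuotients.

Section FiniteModel.
Local Open Scope group_scope.
Local Open Scope classical_set_scope.
Variables (R : realType) (w : free_ultrafilter).

(** Freeness puts the complement of each singleton in [w], hence every tail. *)
Lemma near_ge n : \forall k \near fu_sets w, (n <= k)%N.
Proof.
have W1 i : fu_sets w (~` [set i]).
  have [H|//] := in_ultra_setVsetC [set i] (fu_ultra w).
  have : ~ (\bigcap_(A in fu_sets w) A) i by rewrite fu_free.
  move=> /existsNP[A /not_implyP[wA Ai]].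
  by apply: filterS wA => j Aj ji; apply: Ai; rewrite -ji.
elim: n => [|n IH]; first by near=> k.
apply: filterS2 IH (W1 n) => k nk kn; rewrite ltn_neqAle nk andbT.
by apply/eqP => e; apply: kn.
Unshelve. all: by end_near.
Qed.

Lemma fg_eval_upi (n : posseq) (p : 'I_2 -> permseq n) (g : F2) :
  fg_eval (fun j => upi R w (p j)) g = upi R w (fun k => fg_eval (fun j => p j k) g).
Proof.
rewrite /fg_eval; elim: (fg_word g) => [|a l IH] //=.
rewrite IH {1}/letter_eval; case E : a.2; rewrite ?upiV upiM; congr upi;
  by apply/functional_extensionality_dep => k; rewrite /letter_eval E.
Qed.

Variables (X : nat -> finType) (th : forall k, 'I_2 -> {perm X k}).
Hypothesis X_gt0 : forall k, (0 < #|X k|)%N.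
Hypothesis X_ge : forall k, (k <= #|X k|)%N.
Hypothesis th_free : forall (g : F2) k, g != 1 -> (size g < k)%N ->
  forall x, fg_eval (th k) g x != x.

Definition model_dim : posseq := PosSeq X_gt0.
Definition model_gen (j : 'I_2) : permseq model_dim := fun k => ord_perm (th k j).
Definition model_hom (g : F2) : ultraprod R w model_dim :=
  fg_eval (fun j => upi R w (model_gen j)) g.

Lemma model_homM : {morph model_hom : g h / g * h}.
Proof. exact: fg_evalM. Qed.

HB.instance Definition _ := isMultiplicative.Build _ _ model_hom model_homM.

Lemma model_dim_cvg : model_dim k @[k --> \oo] --> \oo.
Proof.
apply/cvgnyPge => A; near=> k; apply: leq_trans (X_ge k).
by near: k; exact: nbhs_infty_ge.
Unshelve. all: by end_near.
Qed.

Lemma model_tr0 g : g != 1 -> up_tr (model_hom g) = 0%R.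
Proof.
move=> g1; rewrite /model_hom fg_eval_upi up_trE; apply: (cvg_lim (@norm_hausdorff _ _)).
apply: cvg_near_cst; apply: filterS (near_ge (size g).+1) => k gk.
rewrite ntrE (_ : [set i | _]%SET = finset.set0) ?cards0 ?mul0r //.
apply/setP => i; rewrite !inE; apply/negbTE.
have -> : fg_eval (fun j => model_gen j k) g = ord_perm (fg_eval (th k) g).
  by rewrite (fg_eval_morph (h := @ord_perm (X k))) //; exact: ord_permM.
by rewrite -(inj_eq enum_val_inj) ord_permE th_free.
Qed.

Definition model : sofic_rep R w F2 := SoficRep model_dim_cvg model_tr0.

Lemma model_genE j : model (fg_gen j) = upi R w (model_gen j).
Proof. exact: fg_eval_gen. Qed.

End FiniteModel.

(** * Conjugacy in ultraproducts *)

Section Conjugacy.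
Local Open Scope group_scope.
Variables (R : realType) (n r m t : nat) (e : (n * r = m * t)%N).

(** Since [q ^ u] is [u^-1 * q * u], it is the inverse of [u] that intertwines the two actions. *)
Definition conj_map (u : 'S_(m * t)) (z : 'I_n * 'I_r) : 'I_m * 'I_t :=
  mxtens_unindex (u^-1 (cast_ord e (mxtens_index z))).

Lemma conj_map_inj u : injective (conj_map u).
Proof.
move=> z z' /(can_inj (@mxtens_unindexK _ _))/perm_inj/cast_ord_inj.
exact: (can_inj (@mxtens_indexK _ _)).
Qed.

Lemma amp_perm_pamp a b (p : 'S_a) (z : 'I_a * 'I_b) :
  amp_perm b p (mxtens_index z) = mxtens_index (pamp 'I_b p z).
Proof. by case: z => i j; rewrite amp_permE pampE. Qed.

Lemma conj_map_error u (p : 'S_n) (q : 'S_m) : (0 < m * t)%N ->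
  dH R (cast_perm e (amp_perm r p)) (amp_perm t q ^ u) =
  (#|[set z | conj_map u (pamp 'I_r p z) != pamp 'I_t q (conj_map u z)]%SET|%:R / (m * t)%:R)%R.
Proof.
move=> mt; rewrite dHE //; congr (_%:R / _)%R.
pose h z := cast_ord e (mxtens_index z) : 'I_(m * t).
have hi : injective h by move=> z z' /cast_ord_inj/(can_inj (@mxtens_indexK _ _)).
have hK i : exists z, i = h z.
  exists (mxtens_unindex (cast_ord (esym e) i)).
  by rewrite /h mxtens_unindexK cast_ordKV.
rewrite -[RHS](card_imset _ hi); apply: eq_card => i; have [z ->] := hK i.
rewrite mem_imset // !inE; congr (~~ _).
rewrite cast_permE /h cast_ordK amp_perm_pamp /conjg !permM.
rewrite -[RHS](inj_eq (can_inj (@mxtens_indexK _ _))) -!amp_perm_pamp /conj_map !mxtens_unindexK.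
by rewrite -[RHS](inj_eq (@perm_inj _ u)) permKV amp_perm_pamp.
Qed.

Lemma conj_map_surj (g : 'I_n * 'I_r -> 'I_m * 'I_t) : injective g ->
  exists u, conj_map u =1 g.
Proof.
move=> gi.
have vi : injective (fun i : 'I_(m * t) =>
    mxtens_index (g (mxtens_unindex (cast_ord (esym e) i)))).
  move=> i j /(can_inj (@mxtens_indexK _ _))/gi/(can_inj (@mxtens_unindexK _ _)).
  exact: cast_ord_inj.
exists (perm vi)^-1 => z; rewrite /conj_map invgK permE cast_ordK !mxtens_indexK //.
Qed.

End Conjugacy.

(** * Equivalence in terms of almost equivariant bijections *)

Section Sequences.
Local Open Scope group_scope.
Local Open Scope classical_set_scope.
Variables (R : realType) (w : free_ultrafilter).
Local Notation rep := generic_quotient.repr.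
Implicit Types T P : sofic_rep R w F2.

Definition conj_error (n r m t : posseq) (p : 'I_2 -> permseq n) (q : 'I_2 -> permseq m)
    (g : forall k, 'I_(n k) * 'I_(r k) -> 'I_(m k) * 'I_(t k)) k : nat :=
  eqv_error (fun j => pamp 'I_(r k) (p j k)) (fun j => pamp 'I_(t k) (q j k)) (@g k).

Lemma upiJ (n : posseq) (q u : permseq n) :
  upi R w q ^ upi R w u = upi R w (fun k => q k ^ u k).
Proof. by rewrite /conjg (upiM R w q) upiV upiM. Qed.

Section Criterion.
Variables (T P : sofic_rep R w F2).
Local Notation n := (sofic_dim T).
Local Notation m := (sofic_dim P).
Variables (p : 'I_2 -> permseq n) (q : 'I_2 -> permseq m).
Hypothesis Tp : forall j, T (fg_gen j) = upi R w (p j).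
Hypothesis Pq : forall j, P (fg_gen j) = upi R w (q j).

Lemma sofic_equiv_map : sofic_equiv T P ->
  exists (r t : posseq) (g : forall k, 'I_(n k) * 'I_(r k) -> 'I_(m k) * 'I_(t k)),
    [/\ forall k, (n k * r k = m k * t k)%N, forall k, injective (@g k) &
      ((conj_error p q g k)%:R / (n k * r k)%:R)%R @[k --> fu_sets w] --> (0 : R)%R].
Proof.
case=> r [t [e [U H]]]; exists r, t.
exists (fun k => conj_map (e k) (rep U k)); split => [k|k|]; first exact: (e k).
  exact: conj_map_inj.
pose d j k := dH R (cast_perm (e k) (amp_perm (r k) (p j k))) (amp_perm (t k) (q j k) ^ rep U k).
have D j : d j k @[k --> fu_sets w] --> (0 : R)%R.
  have := H (fg_gen j); rewrite /= /amp_hom Tp Pq !up_ampE up_castE -[U]upiK upiJ => /upiP; exact.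
apply: cvg0_squeeze (cvg0_add (D ord0) (D ord_max)) => k.
rewrite divr_ge0 //= /d !conj_map_error ?muln_gt0 ?posseq_gt0 // -mulrDl -natrD.
have ek : (n k * r k = m k * t k)%N := e k.
rewrite ek ler_wpM2r ?invr_ge0 // ler_nat /conj_error /eqv_error big_ord_recl big_ord1.
by rewrite leq_add2l (_ : lift ord0 ord0 = ord_max) //; exact: val_inj.
Qed.

Lemma map_sofic_equiv (r t : posseq)
    (g : forall k, 'I_(n k) * 'I_(r k) -> 'I_(m k) * 'I_(t k)) :
  (forall k, n k * r k = m k * t k)%N -> (forall k, injective (@g k)) ->
  ((conj_error p q g k)%:R / (n k * r k)%:R)%R @[k --> fu_sets w] --> (0 : R)%R ->
  sofic_equiv T P.
Proof.
move=> e gi g0.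
have [u Hu] : exists u : permseq (posseq_mul m t), forall k, conj_map (e k) (u k) =1 @g k.
  have := fun k => cid (conj_map_surj (e k) (gi k)) => H.
  by exists (fun k => projT1 (H k)) => k; exact: projT2 (H k).
exists r, t, e, (upi R w u).
apply: fg_hom_ext.
- by move=> x y; rewrite gmulfM up_castM.
- by move=> x y; rewrite gmulfM conjMg.
move=> j; rewrite /= /amp_hom Tp Pq !up_ampE up_castE upiJ; apply/upiP.
apply: cvg0_squeeze g0 => k; rewrite dH_ge0 /=.
rewrite conj_map_error ?muln_gt0 ?posseq_gt0 // -(e k) ler_wpM2r // ler_nat.
rewrite /conj_error /eqv_error (bigD1 j) //=; apply: leq_trans (leq_addr _ _).
by apply/subset_leq_card/fintype.subsetP => z; rewrite !inE !Hu.
Qed.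

End Criterion.

(* For each [k] take the best precision [<= k] available at [k].               *)
Lemma diagonal_choice (Q : nat -> nat -> Prop) :
  (forall k, Q k 0) -> (forall i, \forall k \near fu_sets w, Q k i) ->
  exists f : nat -> nat, (forall k, Q k (f k)) /\
    forall i, \forall k \near fu_sets w, (i <= f k)%N.
Proof.
move=> Q0 Qw.
have H k : exists i, Q k i /\ forall i', (i' <= k)%N -> Q k i' -> (i' <= i)%N.
  pose P i := `[< Q k i >] && (i <= k)%N.
  have exP : exists i, P i by exists 0%N; rewrite /P leq0n andbT; apply/asboolP.
  have bP i : P i -> (i <= k)%N by case/andP.
  case: (ex_maxnP exP bP) => i /andP[/asboolP Qi _] imax; exists i; split => // i' i'k Qi'.
  by apply: imax; rewrite /P i'k andbT; apply/asboolP.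
have [f Hf] := choice H; exists f; split => [k|i]; first by case: (Hf k).
apply: filterS2 (Qw i) (near_ge w i) => k Qki ik.
by case: (Hf k) => _; apply.
Qed.

Lemma cvg0_nat_bound (a b f : nat -> nat) :
  (forall i, \forall k \near fu_sets w, (i <= f k)%N) ->
  (forall k, (0 < b k)%N) -> (forall k, (f k * a k <= b k)%N) ->
  ((a k)%:R / (b k)%:R)%R @[k --> fu_sets w] --> (0 : R)%R.
Proof.
move=> finf b0 fab; apply/cvgrPdist_lt => eps eps0.
have := finf (Num.bound (eps^-1))%R; apply: filterS => k fk.
rewrite sub0r normrN ger0_norm ?divr_ge0 // ltr_pdivrMr ?ltr0n //.
have h : (eps^-1 < (f k)%:R)%R.
  apply: lt_le_trans (_ : (Num.bound eps^-1)%:R <= _)%R; last by rewrite ler_nat.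
  by rewrite archi_boundP // invr_ge0 ltW.
have fk0 : (0 < (f k)%:R :> R)%R by apply: lt_trans h; rewrite invr_gt0.
have hb : ((f k)%:R * (a k)%:R <= (b k)%:R :> R)%R by rewrite -natrM ler_nat.
have b0' : (0 < (b k)%:R :> R)%R by rewrite ltr0n.
have h' : (1 < eps * (f k)%:R)%R by rewrite mulrC -ltr_pdivrMr // div1r.
rewrite -(ltr_pM2l fk0) (le_lt_trans hb) // mulrA [((f k)%:R * eps)%R]mulrC.
by rewrite ltr_pMl.
Qed.

Lemma nat_bound_cvg0 (a b : nat -> nat) (c : nat) : (forall k, (0 < b k)%N) ->
  ((a k)%:R / (b k)%:R)%R @[k --> fu_sets w] --> (0 : R)%R ->
  \forall k \near fu_sets w, (c * a k < b k)%N.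
Proof.
move=> b0 /cvgrPdist_lt/(_ (c.+1%:R^-1)%R); rewrite invr_gt0 ltr0n => /(_ isT).
apply: filterS => k; rewrite sub0r normrN ger0_norm ?divr_ge0 //.
rewrite ltr_pdivrMr ?ltr0n // mulrC ltr_pdivlMr ?ltr0n // -natrM ltr_nat => h.
by apply: leq_ltn_trans h; rewrite mulnC leq_mul2l leqnSn orbT.
Qed.

End Sequences.

(** * The models and their classes *)

Section Models.
Local Open Scope group_scope.
Local Open Scope classical_set_scope.
Variables (R : realType) (w : free_ultrafilter).
Local Notation rep := generic_quotient.repr.

Definition expander_perm N : 'I_16 -> {perm 'I_N} := projT1 (cid (exists_expander R 'I_N)).

Lemma expander_permP N : expander (@expander_perm N).
Proof. exact: projT2 (cid (exists_expander R 'I_N)). Qed.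

Definition word_group k : finGroupType := {perm {bseq k of 'I_2 * bool}}.

Definition word_gen k : 'I_2 -> word_group k := projT1 (cid (exists_separating k)).

Lemma word_gen_neq1 k (g : F2) : g != 1 -> (size g < k)%N -> fg_eval (@word_gen k) g != 1.
Proof. by move=> g1 gk; have := projT2 (cid (exists_separating k)); apply. Qed.

Lemma word_group_gt0 k : (0 < #|word_group k|)%N.
Proof. by apply/card_gt0P; exists 1. Qed.

(* The factor 32 = 2 * 16 makes the base ['I_(base_size f k)] at least twice    *)
(* as large as a whole model with a smaller exponent at [k].                   *)
Definition block_size k : nat := (32 * #|word_group k| * k.+1)%N.

Lemma block_size_gt0 k : (0 < block_size k)%N.
Proof. by rewrite !muln_gt0 word_group_gt0. Qed.

Implicit Type f : nat -> nat.

Definition base_size f k : nat := (block_size k ^ (f k).+1)%N.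

Definition th_set f k : finType := ('I_(base_size f k) * 'I_16 * word_group k)%type.

Definition th_act f k : 'I_2 -> {perm th_set f k} :=
  skew_perm (two_gen (@expander_perm (base_size f k))) (@word_gen k).

Lemma card_th_set f k : #|th_set f k| = (base_size f k * 16 * #|word_group k|)%N.
Proof. by rewrite !card_prod !card_ord. Qed.

Lemma th_set_gt0 f k : (0 < #|th_set f k|)%N.
Proof. by rewrite card_th_set !muln_gt0 expn_gt0 block_size_gt0 word_group_gt0. Qed.

Lemma th_set_ge f k : (k <= #|th_set f k|)%N.
Proof.
rewrite card_th_set -mulnA; apply: (@leq_trans (base_size f k)).
  (* The factor [k.+1] of [block_size] makes the dimensions tend to infinity. *)
  apply: (@leq_trans (block_size k)).
    by rewrite /block_size (leq_trans (leqnSn k)) // leq_pmull // muln_gt0 word_group_gt0.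
  by rewrite /base_size expnS leq_pmulr // expn_gt0 block_size_gt0.
by rewrite leq_pmulr // muln_gt0 word_group_gt0.
Qed.

Lemma th_act_free f (g : F2) k : g != 1 -> (size g < k)%N ->
  forall x, fg_eval (@th_act f k) g x != x.
Proof.
move=> g1 gk x; apply/eqP => /(congr1 snd) /=; rewrite skew_perm_eval.
move/(canRL (mulKg _)); rewrite mulVg; apply/eqP; exact: word_gen_neq1.
Qed.

Definition theta f : sofic_rep R w F2 :=
  model R w (th_set_gt0 f) (th_set_ge f) (@th_act_free f).

Definition theta_gen f (j : 'I_2) : permseq (sofic_dim (theta f)) :=
  model_gen (@th_act f) (th_set_gt0 f) j.

Lemma theta_genE f j : theta f (fg_gen j) = upi R w (theta_gen f j).
Proof. exact: model_genE. Qed.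

Lemma base_size_lt f f' k : (f' k < f k)%N -> (2 * #|th_set f' k| <= base_size f k)%N.
Proof.
move=> ff; rewrite card_th_set.
apply: (@leq_trans (base_size f' k * block_size k)).
  rewrite /block_size; set b := base_size _ _; set q := #|_|; nia.
by rewrite /base_size -expnSr leq_pexp2l ?block_size_gt0.
Qed.

(** Projected to the base of the larger model, an equivalence is an almost equivariant map on an
    amplification of the smaller one. Its best column is defined on the smaller model itself and
    contradicts [expander_no_small_image]. *)
Lemma theta_separated f f' : (\forall k \near fu_sets w, (f' k < f k)%N) ->
  ~ sofic_equiv (theta f') (theta f).
Proof.
move=> ff' /(sofic_equiv_map (theta_genE f') (theta_genE f))[r [t [g [_ _ g0]]]].
have dim0 k : (0 < sofic_dim (theta f') k * r k)%N by rewrite muln_gt0 !posseq_gt0.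
have [k [fk]] := filter_ex (filterI ff' (nat_bound_cvg0 (2 ^ 14 * 2) dim0 g0)).
apply/negP; rewrite -leqNgt.
pose y (z : 'I_#|th_set f k| * 'I_(t k)) : 'I_(base_size f k) * 'I_16 := (enum_val z.1).1.
have yE j z : y (pamp 'I_(t k) (theta_gen f j k) z) =
    two_gen (@expander_perm (base_size f k)) j (y z).
  by rewrite /y pampE ord_permE /th_act skew_permE.
have le1 := eqv_error_compl (fun j => pamp 'I_(r k) (theta_gen f' j k)) (@g k) yE.
have [|v le2] := exists_column (fun j => theta_gen f' j k)
  (two_gen (@expander_perm (base_size f k))) (y \o @g k); first by rewrite card_ord posseq_gt0.
have le3 := @expander_no_small_image _ _ (fun j => theta_gen f' j k) _
  (fun x => (y \o @g k) (x, v)) (@expander_permP (base_size f k)).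
rewrite !card_ord in le2 le3.
have le4 := leq_trans le2 le1.
move: le3 => /(_ (base_size_lt fk)); move: (2 ^ 14)%N => K le3.
apply: leq_trans (leq_mul le3 (leqnn (r k))) _.
rewrite -!mulnA; apply: leq_mul => //; apply: leq_mul => //.
by rewrite mulnC.
Qed.

Lemma cvg_pos_bound (a b : nat -> nat) (l : R) : (0 < l)%R -> (forall k, 0 < b k)%N ->
  ((a k)%:R / (b k)%:R)%R @[k --> fu_sets w] --> l ->
  exists d, (0 < d)%N /\ \forall k \near fu_sets w, (b k <= d * a k)%N.
Proof.
move=> l0 b0 /cvgrPdist_lt/(_ (l / 2)%R); rewrite divr_gt0 // => /(_ isT) H.
have i0 : (0 <= (l / 2)^-1)%R by rewrite invr_ge0 divr_ge0 // ltW.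
exists (Num.bound (l / 2)^-1)%R.+1; split => //; apply: filterS H => k.
rewrite ltr_norml => /andP[_ h].
have h1 : (l / 2 < (a k)%:R / (b k)%:R)%R by lra.
have b0' : (0 < (b k)%:R :> R)%R by rewrite ltr0n.
rewrite ltr_pdivlMr // in h1.
have h2 := archi_boundP i0.
rewrite -(ler_nat R) natrM.
have l20 : (0 < l / 2)%R by rewrite divr_gt0.
have h3 : ((b k)%:R < (l / 2)^-1 * (a k)%:R)%R.
  by rewrite -ltr_pdivrMl ?invr_gt0 // invrK.
apply: le_trans (ltW h3) _; apply: ler_wpM2r => //.
by rewrite (le_trans (ltW h2)) // ler_nat.
Qed.

Section Piece.
Variable f : nat -> nat.
Variables T S : sofic_rep R w F2.
Local Notation n := (sofic_dim T).
Local Notation m := (sofic_dim S).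
Variables (p : 'I_2 -> permseq n) (q : 'I_2 -> permseq m).
Hypothesis Tp : forall j, T (fg_gen j) = upi R w (p j).
Hypothesis Sq : forall j, S (fg_gen j) = upi R w (q j).
Variables (r : posseq) (io : forall k, 'I_(n k) * 'I_(r k) -> 'I_(m k)) (l : R).
Hypothesis io_inj : forall k, injective (@io k).
Hypothesis io_eqv : forall k j z, io (pamp 'I_(r k) (p j k) z) = q j k (io z).
Hypothesis l_gt0 : (0 < l)%R.
Hypothesis dens : ((n k * r k)%:R / (m k)%:R)%R @[k --> fu_sets w] --> l.

(** Restricted to the copy [io] of [T] inside [S], the equivalence of [S] with [theta f] is an
    injection of small error whose image has density bounded below, as [absorb] requires. *)
Lemma piece_near_iso : sofic_equiv S (theta f) ->
  forall i, \forall k \near fu_sets w, near_iso (fun j => p j k) (@th_act f k) i.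
Proof.
case/(sofic_equiv_map Sq (theta_genE f)) => b [a [g [gdim g_inj g0]]] i.
have n0 k : (0 < n k)%N := posseq_gt0 n k.
case: (posnP i) => [->|i0].
  by near=> k; apply: near_iso0; rewrite ?card_ord ?th_set_gt0.
have [|d [d0 Hd]] := @cvg_pos_bound (fun k => n k * r k)%N (fun k => m k) l l_gt0 _ dens.
  by move=> k; exact: posseq_gt0.
have dim0 k : (0 < m k * b k)%N by rewrite muln_gt0 !posseq_gt0.
set K := (2 ^ 14)%N.
apply: filterS2 Hd (nat_bound_cvg0 (d * absorb_factor K i d) dim0 g0) => k mk.
set e := conj_error _ _ _ _ => ek.
pose io' (z : 'I_(n k) * ('I_(r k) * 'I_(b k))) : 'I_(m k) * 'I_(b k) :=
  (io (z.1, z.2.1), z.2.2).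
have io'_inj : injective io'.
  move=> [x [y z]] [x' [y' z']] ee; have /= -> := congr1 snd ee.
  by have /= /io_inj [-> ->] := congr1 fst ee.
have io'_eqv j z : io' (pamp _ (p j k) z) = pamp _ (q j k) (io' z).
  by rewrite /io' !pampE -io_eqv pampE.
pose ev (z : 'I_#|th_set f k| * 'I_(a k)) : th_set f k * 'I_(a k) := (enum_val z.1, z.2).
have ev_inj : injective ev.
  move=> [x y] [x' y'] ee; have /= -> := congr1 snd ee.
  by have /= /enum_val_inj -> := congr1 fst ee.
have ev_eqv j z : ev (pamp _ (theta_gen f j k) z) = pamp _ (@th_act f k j) (ev z).
  by rewrite /ev !pampE ord_permE.
have le1 := eqv_error_compl (fun j => pamp 'I_(b k) (q j k)) (@g k) ev_eqv.
have le2 := eqv_error_comp (fun j => pamp 'I_(a k) (@th_act f k j)) (ev \o @g k) io'_inj io'_eqv.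
have le3 := leq_trans le2 le1.
apply: (@absorb _ _ _ _ K _ _ _ _ d (a k) _ ((ev \o @g k) \o io')) => //.
- by move=> h; apply: two_gen_poincare; exact: expander_permP.
- by rewrite card_ord.
- by rewrite card_prod !card_ord muln_gt0 !posseq_gt0.
- exact: inj_comp (inj_comp ev_inj (g_inj k)) io'_inj.
- apply: (@leq_trans (m k * b k)).
    exact: eq_leq (etrans (congr1 (muln^~ (a k)) (esym (card_prod _ _))) (esym (gdim k))).
  by rewrite card_prod !card_ord !mulnA leq_mul2r -mulnA mk orbT.
- rewrite -(leq_pmul2l d0); apply: (@leq_trans (m k * b k)).
    apply: leq_trans (ltnW ek); rewrite mulnA; exact: leq_mul (leqnn _) le3.
  by rewrite card_prod !card_ord !mulnA leq_mul2r -mulnA mk orbT.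
Unshelve. all: by end_near.
Qed.

(** Each precision is reached for [w]-almost all [k]; [diagonal_choice] lets it tend to infinity,
    with precision 0 as the fallback. *)
Lemma piece_equiv : sofic_equiv S (theta f) -> sofic_equiv T (theta f).
Proof.
move=> ST; have n0 k : (0 < n k)%N := posseq_gt0 n k.
have near0 k : near_iso (fun j => p j k) (@th_act f k) 0.
  by apply: near_iso0; rewrite ?card_ord ?th_set_gt0.
have [h [hQ hw]] := diagonal_choice near0 (piece_near_iso ST).
have [rr H1] := choice hQ; have [qq H2] := choice H1.
pose H k := cid (H2 k).
have rr0 k : (0 < rr k)%N by case: (projT2 (H k)).
have qq0 k : (0 < qq k)%N by case: (projT2 (H k)).
pose er k (z : th_set f k * 'I_(qq k)) : 'I_#|th_set f k| * 'I_(qq k) := (enum_rank z.1, z.2).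
have er_inj k : injective (@er k).
  move=> [x y] [x' y'] ee; have /= -> := congr1 snd ee.
  by have /= /enum_rank_inj -> := congr1 fst ee.
have er_eqv k j z : er k (pamp _ (@th_act f k j) z) = pamp _ (theta_gen f j k) (er k z).
  rewrite /er !pampE /=; congr (_, _); apply: enum_val_inj.
  by rewrite ord_permE !enum_rankK.
pose g k : 'I_(n k) * 'I_(PosSeq rr0 k) -> 'I_(sofic_dim (theta f) k) * 'I_(PosSeq qq0 k) :=
  er k \o projT1 (H k).
apply: (@map_sofic_equiv _ _ _ _ _ _ Tp (theta_genE f) (PosSeq rr0) (PosSeq qq0) g).
- by move=> k; have [_ _ e _ _] := projT2 (H k); move: e; rewrite card_ord.
- by move=> k; have [_ _ _ gi _] := projT2 (H k); exact: inj_comp (@er_inj k) gi.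
apply: (@cvg0_nat_bound R w _ _ h) => // k; first by rewrite muln_gt0 n0 rr0.
have [_ _ _ _ ge] := projT2 (H k).
apply: (@leq_trans (#|'I_(n k)| * rr k)%N); last by rewrite card_ord.
apply: leq_trans ge; apply: leq_mul => //.
exact: (eqv_error_compl _ _ (er_eqv k)).
Qed.

End Piece.

Lemma theta_extreme f : extreme_point (sofic_class (theta f)).
Proof.
move=> l c1 c2 /andP[l0 l1] [T [P [r [t [-> -> ratio cE]]]]].
set S := sofic_dsum _ _ in cE.
have ST : sofic_equiv S (theta f) by apply: sofic_equiv_sym; apply/sofic_classP.
pose p j := rep (T (fg_gen j)); pose p' j := rep (P (fg_gen j)).
pose q (j : 'I_2) : permseq (sofic_dim S) :=
  fun k => dsum_perm (amp_perm (r k) (p j k)) (amp_perm (t k) (p' j k)).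
have Tp j : T (fg_gen j) = upi R w (p j) by rewrite upiK.
have Pp j : P (fg_gen j) = upi R w (p' j) by rewrite upiK.
have Sq j : S (fg_gen j) = upi R w (q j).
  by rewrite /= /dsum_hom /= /amp_hom Tp Pp !up_ampE up_dsumE.
split; apply/sofic_classP.
  apply: (@piece_equiv f T S p q Tp Sq r (fun k z => lshift _ (mxtens_index z)) l) => //.
  - by move=> k z z' /lshift_inj/(can_inj (@mxtens_indexK _ _)).
  - by move=> k j z; rewrite dsum_perml amp_perm_pamp.
apply: (@piece_equiv f P S p' q Pp Sq t (fun k z => rshift _ (mxtens_index z)) (1 - l)%R) => //.
- by move=> k z z' /rshift_inj/(can_inj (@mxtens_indexK _ _)).
- by move=> k j z; rewrite dsum_permr amp_perm_pamp.
- by rewrite subr_gt0.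
have -> : (fun k => (sofic_dim P k * t k)%:R / (sofic_dim S k)%:R)%R =
    (fun k => 1 - (sofic_dim T k * r k)%:R / (sofic_dim T k * r k + sofic_dim P k * t k)%:R :> R)%R.
  apply/funext => k /=; rewrite natrD; set x : R := ((_ * r k)%N%:R)%R; set y : R := ((_ * t k)%N%:R)%R.
  have : (0 < x + y)%R by rewrite -natrD ltr0n addn_gt0 muln_gt0 !posseq_gt0.
  move=> /lt0r_neq0 xy; apply: (mulIf xy).
  by rewrite mulrBl mul1r !divfK // [(x + y)%R]addrC addrK.
by apply: cvgB => //; exact: cvg_cst.
Qed.

End Models.

(** * Uncountability by diagonalisation *)

Local Open Scope classical_set_scope.

Theorem mainTheorem3 (R : realType) (w : free_ultrafilter) :
  ~ countable [set c : Sof R w F2 | extreme_point c].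
Proof.
move=> /countable_injP[h hi].
pose H (f : nat -> nat) : nat := h (sofic_class (theta R w f)).
(* Choose for each code [i] a sequence whose class has that code, if there is one. *)
pose P i (f : nat -> nat) : Prop := (exists f', H f' = i) -> H f = i.
have exP i : exists f, P i f.
  have [[f Hf]|Hn] := pselect (exists f', H f' = i); first by exists f.
  by exists (fun=> 0%N) => /Hn.
have [F HF] := choice exP.
(* This [f] exceeds [F i] at every [k >= i]. *)
pose f k := (\max_(i < k.+1) F i k).+1%N.
have E : H (F (H f)) = H f by apply: HF; exists f.
have := hi _ _ _ _ E; rewrite !inE => /(_ (@theta_extreme R w _) (@theta_extreme R w _)).
(* [F (H f)] has the code of [f], hence the same class, although it lies below [f] from index [H f]
   on. *)
move/sofic_classP; apply: theta_separated.
apply: filterS (near_ge w (H f)) => k Hk.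
rewrite /f ltnS.
have Hk' : (H f < k.+1)%N by rewrite ltnS.
exact: (@leq_bigmax _ (fun i : 'I_k.+1 => F i k) (Ordinal Hk')).
Qed.
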